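(* A minimal distal metric dynamical system $(X,\Gamma)$ is injective if and only if it is equicontinuous.
   Context: A dynamical system $(X,\Gamma)$: compact Hausdorff $X$ with a continuous action of a topological group $\Gamma$; metric means $X$ metrizable. $E(X,\Gamma)$ denotes the enveloping semigroup, the pointwise closure in $X^X$ of $\{x\mapsto \gamma x:\gamma\in\Gamma\}$. Let $M(X)$ be the space of Borel probability measures on $X$ with the weak$^*$ topology and the induced action $(\gamma\nu)(f)=\nu(f\circ\gamma)$. Identifying $X$ with the Dirac measures $\{\delta_x\}\subset M(X)$, each element of $E(M(X),\Gamma)$ restricts to an element of $E(X,\Gamma)$, giving a natural surjective homomorphism $E(M(X),\Gamma)\to E(X,\Gamma)$. The system is called injective if this natural map is an isomorphism. Minimal: every orbit is dense. Distal: $x\neq y$ implies $\inf$ over $\gamma$ of $d(\gamma x,\gamma y)>0$ (no nontrivial proximal pairs). *)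

(* Defs.v *)
From HB Require Import structures.
From mathcomp Require Import all_boot all_order all_algebra.
From mathcomp Require Import all_classical all_reals all_analysis.

Set Implicit Arguments.
Unset Strict Implicit.
Unset Printing Implicit Defensive.

Import Order.TTheory GRing.Theory Num.Theory.
Import numFieldNormedType.Exports.
Local Open Scope classical_set_scope.
Local Open Scope ring_scope.

Definition topological_group (G : topologicalType)
    (mul : G -> G -> G) (one : G) (inv : G -> G) : Prop :=
  [/\ (forall a b c, mul a (mul b c) = mul (mul a b) c),
      (forall a, mul one a = a /\ mul a one = a),
      (forall a, mul (inv a) a = one /\ mul a (inv a) = one),
      continuous (fun p : G * G => mul p.1 p.2) &
      continuous inv].

Definition continuous_action (G X : topologicalType)
    (mul : G -> G -> G) (one : G) (act : G -> X -> X) : Prop :=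
  [/\ (forall x, act one x = x),
      (forall g h x, act (mul g h) x = act g (act h x)) &
      continuous (fun p : G * X => act p.1 p.2)].

Definition minimal_action (G X : topologicalType) (act : G -> X -> X) : Prop :=
  forall x : X, closure (range (fun g => act g x)) = [set: X].

Definition distal_action (R : numDomainType) (G : topologicalType)
    (X : pseudoMetricType R) (act : G -> X -> X) : Prop :=
  forall x y : X, x <> y ->
    exists e : R, 0 < e /\ forall g : G, ~ ball (act g x) e (act g y).

(* Enveloping semigroup E(X,G): pointwise closure in X^X of the maps   *)
(* x |-> g x.  Membership of phi : X -> X, written out with the basic  *)
(* neighbourhoods of the product (pointwise) topology.                 *)
Definition in_enveloping (G X : topologicalType) (act : G -> X -> X)
    (phi : X -> X) : Prop :=
  forall (n : nat) (xs : 'I_n -> X) (U : 'I_n -> set X),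
    (forall i, open (U i) /\ U i (phi (xs i))) ->
    exists g : G, forall i, U i (act g (xs i)).

Definition borel_type (X : topologicalType) := g_sigma_algebraType (@open X).

Section ProbMeasures.
Context (R : realType) (X : pseudoPMetricType R).

Definition MX := probability (borel_type X) R.

Definition diracM (x : X) : MX := @dirac _ (borel_type X) x R.

Definition meas_eq (mu nu : MX) : Prop :=
  forall A : set (borel_type X), measurable A -> mu A = nu A.

(* E(M(X),G): pointwise closure in M(X)^M(X) of the maps nu |-> g nu,
   where (g nu)(f) = nu(f o g) and M(X) carries the weak-* topology
   (basic neighbourhoods given by finitely many continuous f and an
   epsilon).  Membership written out with the basic neighbourhoods of
   the product of weak-* topologies. *)
Definition in_enveloping_M (G : topologicalType) (act : G -> X -> X)
    (p : MX -> MX) : Prop :=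
  forall (n m : nat) (nus : 'I_n -> MX) (fs : 'I_m -> X -> R),
    (forall j, continuous (fs j)) ->
    forall eps : R, 0 < eps ->
    exists g : G, forall i j,
      (`| \int[p (nus i)]_x (fs j x)%:E
          - \int[nus i]_x (fs j (act g x))%:E | < eps%:E)%E.

Definition restricts_to (p : MX -> MX) (phi : X -> X) : Prop :=
  forall x : X, meas_eq (p (diracM x)) (diracM (phi x)).

(* Injective system: the natural (surjective homomorphism)
   E(M(X),G) -> E(X,G), p |-> p restricted to X, is injective
   (equivalently, an isomorphism). *)
Definition injective_system (G : topologicalType) (act : G -> X -> X) : Prop :=
  forall (p q : MX -> MX) (phi : X -> X),
    in_enveloping_M act p -> in_enveloping_M act q ->
    in_enveloping act phi ->
    restricts_to p phi -> restricts_to q phi ->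
    forall nu : MX, meas_eq (p nu) (q nu).

End ProbMeasures.

(* Main.v *)
Require Import Defs.
From HB Require Import structures.
From mathcomp Require Import all_boot all_order all_algebra.
From mathcomp Require Import all_classical all_reals all_analysis.
From mathcomp Require Import measurable_realfun.
From mathcomp Require Import ring lra.
Set Implicit Arguments.
Unset Strict Implicit.
Unset Printing Implicit Defensive.
Import Order.TTheory GRing.Theory Num.Theory.
Import numFieldNormedType.Exports.
Local Open Scope classical_set_scope.
Local Open Scope ring_scope.

(* An element of E(M(X)) is determined up to e, at a measure nu and a function f, by its values at finitely many
   points as soon as the action is equicontinuous; this gives one direction.

   Conversely, E(X) is a group by distality (Ellis), and injectivity turns E(M(X)) into a group as well. Hence M(X) is
   distal, and for every measure nu and continuous f the functions f o g are precompact in L2(nu).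
   Fix a countable dense set D. Distality of M(X), strict convexity and Zorn's lemma produce measures M_x (x in X)
   which form a limit of averages of translations g that nearly fix D, and which are fixed by all p in E(X) fixing D
   pointwise. If M_x is the Dirac measure at x, then every such p fixes x, so that g x is controlled, uniformly in g,
   by finitely many points g d with d in D. By the Baire category theorem there are two cases. Either this control is
   uniform on a dense subset of an open set; then G is equicontinuous there, hence everywhere by minimality. Or some f
   is moved by at least c under M_x, for all x in a dense subset of an open set U. Then one finds translations g_n
   which nearly fix points of D and move neighbouring points of U by c / 2 on average; a limit of uniform measures on
   such points is a measure nu for which the f o g_n are separated in L1(nu), against precompactness. *)

(** * Ultrafilters and the Ellis group *)

(** Probability measures are treated as positive normalized functionals on C(X). Limits of such
    functionals along ultrafilters exist at once, so E(M(X)) can be studied without measure theory;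
    the Riesz theorem serves to carry injectivity, which is stated for Borel measures, over to
    functionals. Since [G] is an arbitrary group, limits in E(X) run along filters on [G], not along
    sequences. Injectivity yields inverses as follows: if p lies over phi in E(X), choose q over the
    inverse of phi. Then q p and p q lie over the identity of X, and therefore are the identity. The
    obstacle in the converse is that elements of E(X) need not be continuous a priori, so one that
    fixes a dense set may still move other points. The averages M_x detect this. The dense set is
    countable so that the possible degrees of control form a countable family, as Baire's theorem
    demands. In the second case every new translation is found by doubling a finite list of points:
    averages of older gaps are nearly preserved, while the two halves are pulled apart by the new
    translation. *)

Lemma ultra_compact_cvg (S : Type) (T : topologicalType) (U : set_system S)
    (f : S -> T) (K : set T) :
  UltraFilter U -> compact K -> U (f @^-1` K) ->
  exists2 p, K p & f @ U --> p.
Proof.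
move=> UU cK UK.
have [p [Kp clp]] := cK (f @ U) _ UK.
exists p => // V Vp.
have [//|nV] := in_ultra_setVsetC (f @^-1` V) UU.
have [y [/= ny Vy]] := clp (~` V) V nV Vp.
by case: ny.
Qed.

Lemma Zorn_min (T : Type) (Q : set (set T)) (C0 : set T) :
  Q C0 ->
  (forall F : set (set T), F !=set0 -> F `<=` Q -> total_on F subset ->
     Q (\bigcap_(A in F) A)) ->
  exists2 C, Q C & forall C', Q C' -> C' `<=` C -> C' = C.
Proof.
move=> QC0 Qcap.
(* Complements turn intersections into unions; the disjunct [A = set0] takes care of the empty
   chain. *)
have [|A [PA Amax]] := @Zorn_bigcup T [set A | A = set0 \/ Q (~` A)].
  move=> F FP Ftot /=.
  have [F0|nF0] := pselect (forall A, F A -> A = set0).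
    by left; apply/seteqP; split=> // x [A FA]; rewrite (F0 _ FA).
  right.
  have [A0 FA0 A00] : exists2 A, F A & A <> set0.
    by apply: contrapT => h; apply: nF0 => A FA; apply: contrapT => h';
       apply: h; exists A.
  pose F' := [set B | F (~` B) /\ ~` B <> set0].
  rewrite (_ : ~` _ = \bigcap_(B in F') B).
    apply: Qcap.
    - by exists (~` A0); rewrite /F' /= setCK.
    - by move=> B [/FP[//|]]; rewrite ?setCK.
    - move=> B B' [FB _] [FB' _].
      by have [h|h] := Ftot _ _ FB FB'; [right|left]; apply: subsetC2.
  rewrite setC_bigcup; apply/seteqP; split=> x hx.
    by move=> B [FB _]; apply: contrapT => nB; exact: (hx _ FB nB).
  move=> A FA; have [->|nA] := pselect (A = set0); first by [].
  by apply: hx; split; rewrite setCK.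
exists (~` A).
  case: PA => // A0; rewrite A0 setC0.
  (* If the maximal [A] is empty, then [C0] is everything, as otherwise its complement would be
     strictly larger than [A]. *)
  have [<- //|nC0] := pselect (C0 = setT).
  exfalso; apply: (Amax (~` C0)); last by right; rewrite setCK.
  rewrite A0; split => //; move=> /(_ _ _) h; apply: nC0.
  by apply/seteqP; split => // x _; apply: contrapT => /h.
move=> C' QC' C'A; apply/seteqP; split=> // x nAx; apply: contrapT => nC'x.
apply: (Amax (~` C')); last by right; rewrite setCK.
split; first by move=> y Ay /C'A.
by move=> /(_ x nC'x).
Qed.

Section UClosed.
Context {I : Type} {T : topologicalType}.

(** Closedness in the product topology, tested on ultrafilters so that limits are taken one
    coordinate at a time. *)
Definition ptw_closed (C : set (I -> T)) :=
  forall U : set_system (I -> T), UltraFilter U -> U C ->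
    forall s, (forall i, (fun f => f i) @ U --> s i) -> C s.

Definition ptw_compact (K : set (I -> T)) :=
  forall U : set_system (I -> T), UltraFilter U -> U K ->
    exists s : I -> T, forall i, (fun f => f i) @ U --> s i.

Lemma chain_ultra (F : set (set (I -> T))) :
  F !=set0 -> (forall A, F A -> A !=set0) -> total_on F subset ->
  exists U : set_system (I -> T), UltraFilter U /\ F `<=` U.
Proof.
move=> [A0 FA0] Fn Ftot.
pose H := [set B | exists2 A, F A & A `<=` B].
have HF : ProperFilter H.
  apply: Build_ProperFilter_ex.
    by move=> B [A FA AB]; have [x Ax] := Fn _ FA; exists x; apply: AB.
  split.
  - by exists A0.
  - move=> B B' [A FA AB] [A' FA' AB'].
    have [h|h] := Ftot _ _ FA FA'.
      by exists A => // x Ax; split; [apply: AB|apply: AB'; apply: h].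
    by exists A' => // x Ax; split; [apply: AB; apply: h|apply: AB'].
  - by move=> B B' BB' [A FA AB]; exists A => // x /AB/BB'.
have [U [UU HU]] := ultraFilterLemma HF.
by exists U; split => // A FA; apply: HU; exists A.
Qed.

Lemma chain_ptw_closed (F : set (set (I -> T))) (K : set (I -> T)) :
  ptw_compact K ->
  F !=set0 -> (forall A, F A -> [/\ A !=set0, A `<=` K & ptw_closed A]) ->
  total_on F subset -> (\bigcap_(A in F) A) !=set0.
Proof.
move=> cK F0 FP Ftot.
have [|U [UU FU]] := chain_ultra F0 _ Ftot; first by move=> A /FP[].
have UK : U K.
  by case: F0 => A FA; have [_ AK _] := FP _ FA; apply: filterS AK (FU _ FA).
have [s hs] := cK U UU UK.
exists s => A FA; have [_ _ cA] := FP _ FA.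
exact: cA (FU _ FA) _ hs.
Qed.

Lemma ptw_closed_bigcap (F : set (set (I -> T))) :
  (forall A, F A -> ptw_closed A) -> ptw_closed (\bigcap_(A in F) A).
Proof.
move=> FP U UU Ucap s hs A FA; apply: (FP _ FA) hs => //.
by apply: filterS Ucap => f; apply.
Qed.
End UClosed.

Section Bind.
Context {S S' : Type}.
(** A limit along this filter is an iterated limit: first along [k x], then along [F]. It realizes
    limits of limits and composites of limits as single limits. *)
Definition filter_bind (F : set_system S) (k : S -> set_system S') : set_system S' :=
  fun A => F (fun x => k x A).

Lemma filter_bind_proper F k : ProperFilter F ->
  (forall x, ProperFilter (k x)) -> ProperFilter (filter_bind F k).
Proof.
move=> PF Pk; apply: Build_ProperFilter_ex.
  move=> A FA; have /filter_ex[x kxA] : F (fun x => k x A) := FA.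
  by have := Pk x => ?; exact: filter_ex kxA.
split.
- rewrite /filter_bind; apply: filterE => x; have := Pk x => ?; exact: filterT.
- move=> A B; rewrite /filter_bind => FA FB.
  by apply: filterS2 FA FB => x; have := Pk x => ?; exact: filterI.
- move=> A B AB; rewrite /filter_bind; apply: filterS => x.
  by have := Pk x => ?; exact: filterS.
Qed.
End Bind.

(** Failure of uniformity in [i] is caught by one ultrafilter of bad pairs whose second component
    tends to [x]; every equicontinuity statement below is reduced to limits in this way. *)
Lemma near_forall_ultra (X : topologicalType) (I : Type) (x : X) (P : I -> X -> Prop) :
  (forall W : set_system (I * X), UltraFilter W ->
     (forall V, nbhs x V -> W [set p | V p.2]) -> ~ W [set p | ~ P p.1 p.2]) ->
  nbhs x [set y | forall i, P i y].
Proof.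
move=> h; apply: contrapT => hn.
pose H := [set Q : set (I * X) | exists2 V, nbhs x V &
  forall p, V p.2 -> ~ P p.1 p.2 -> Q p].
have PH : ProperFilter H.
  apply: Build_ProperFilter_ex.
    move=> Q [V nV hQ]; apply: contrapT => nQ; apply: hn.
    apply: filterS nV => y Vy i; apply: contrapT => nP.
    by apply: nQ; exists (i, y); exact: hQ.
  split.
  - by exists setT => //; exact: filterT.
  - move=> Q Q' [V nV hQ] [V' nV' hQ']; exists (V `&` V'); first exact: filterI.
    by move=> p [Vp V'p] bp; split; [exact: hQ|exact: hQ'].
  - by move=> Q Q' QQ' [V nV hQ]; exists V => // p Vp bp; apply: QQ'; exact: hQ.
have [W [UW HW]] := ultraFilterLemma PH.
apply: (h W UW) => [V nV|]; apply: HW; first by exists V.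
by exists setT => //; exact: filterT.
Qed.

Section Ellis.
Context {X : topologicalType} {G : Type} (mul : G -> G -> G) (one : G)
  (act : G -> X -> X).
Hypothesis hX : hausdorff_space X.
Hypothesis cX : compact [set: X].
Hypothesis act1 : forall x, act one x = x.
Hypothesis actM : forall g h x, act (mul g h) x = act g (act h x).
Hypothesis actC : forall g, continuous (act g).

(** The enveloping semigroup, with a filter of translations as witness, which can then be applied to
    measures as well. *)
Definition env_elt (phi : X -> X) :=
  exists2 F : set_system G, ProperFilter F &
    forall x, (fun g => act g x) @ F --> phi x.

Lemma ptw_compactT I (K : set (I -> X)) : ptw_compact K.
Proof.
move=> U UU _.
have h i : exists p : X, (fun f : I -> X => f i) @ U --> p.
  by have [|p _ hp] := @ultra_compact_cvg _ _ U (fun f => f i) _ UU cX;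
    [exact: filterT|exists p].
by have [s hs] := choice h; exists s.
Qed.

Lemma env_filter (f : X -> X) : exists F : set_system G, ProperFilter F /\
  (env_elt f -> forall x, (fun g => act g x) @ F --> f x).
Proof.
have [[F PF hF]|nf] := pselect (env_elt f); first by exists F.
by exists (principal_filter one); split => //; exact: principal_filter_proper.
Qed.

Lemma env_closed : ptw_closed env_elt.
Proof.
move=> U UU UE s hs.
have [k hk] := choice env_filter.
exists (filter_bind U k); first by apply: filter_bind_proper => f; case: (hk f).
move=> x V; rewrite nbhsE => -[W [oW Wx] WV].
have h : U (fun f => W (f x)) by apply: hs; exact: open_nbhs_nbhs.
rewrite /fmap /= /filter_bind; apply: filterS2 h UE => f Wf Ef.
have [PF /(_ Ef x)] := hk f.
move=> /(_ W) h; apply: filterS WV (h _).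
exact: open_nbhs_nbhs.
Qed.

(** The limit over [h] is taken first, for fixed [g], because [act g] is continuous whereas [phi]
    need not be. *)
Lemma env_comp phi psi : env_elt phi -> env_elt psi -> env_elt (phi \o psi).
Proof.
move=> [F PF hF] [F' PF' hF'].
exists (filter_bind F (fun g => [set A | F' (fun h => A (mul g h))])).
  exact: filter_bind_proper.
move=> x V; rewrite nbhsE => -[W [oW Wx] WV].
have h : F (fun g => W (act g (psi x))) by apply: (hF (psi x)); exact: open_nbhs_nbhs.
apply: filterS h => g Wg.
have : nbhs (psi x) (act g @^-1` W).
  exact: (@actC g (psi x) W (open_nbhs_nbhs (conj oW Wg))).
move=> /(hF' x) h'; apply: (@filterS _ F' _ _ _ _ h') => y /= /WV.
by rewrite actM.
Qed.

Lemma env_id : env_elt id.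
Proof.
exists (principal_filter one); first exact: principal_filter_proper.
by move=> x V /nbhs_singleton Vx; apply/principal_filterP; rewrite /= act1.
Qed.

(** Composition with [phi] on the right is pointwise continuous even for discontinuous [phi], and a
    continuous image of a compact set is closed. *)
Lemma right_translate_closed (C : set (X -> X)) (phi : X -> X) :
  ptw_closed C -> ptw_closed ([set psi \o phi | psi in C] : set (X -> X)).
Proof.
move=> clC U UU UC s hs.
have [c hc] : exists c : (X -> X) -> (X -> X), forall f,
    [set psi \o phi | psi in C] f -> C (c f) /\ c f \o phi = f.
  have h (f : X -> X) : exists c, [set psi \o phi | psi in C] f -> C c /\ c \o phi = f.
    have [[c Cc e]|nf] := pselect ([set psi \o phi | psi in C] f).
      by exists c.
    by exists f.
  by have [c hc] := choice h; exists c.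
have UcP : UltraFilter (c @ U).
  split; first exact: fmap_proper_filter.
  move=> H PH UH; apply/seteqP; split => // A HA.
  have [//|nA] := in_ultra_setVsetC (c @^-1` A) UU.
  have /filter_ex[x [//]] : H (A `&` ~` A).
  by apply: filterI => //; exact: UH.
have [t ht] := @ptw_compactT X setT (c @ U) UcP (filterT).
have Ct : C t.
  apply: clC UcP _ _ ht; rewrite /fmap /=.
  by apply: filterS UC => f /hc[].
exists t => //; apply/funext => x /=.
apply: (@cvg_unique _ hX ((fun f : X -> X => f x) @ U)).
- move=> V Vt; have UV : U (fun f => V (c f (phi x))) := ht (phi x) V Vt.
  change (U (fun f => V (f x))); apply: filterS2 UV UC => f Vf Cf;
  by have [_ e] := hc f Cf; have /= <- := congr1 (@^~ x) e.
- exact: hs.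
Qed.

Hypothesis env_inj : forall phi, env_elt phi -> injective phi.

(* Ellis-Numakura: a minimal closed subsemigroup consists of one idempotent, and an injective idempotent is the
   identity. *)
Lemma env_left_inverse phi : env_elt phi ->
  exists2 psi, env_elt psi & psi \o phi = id.
Proof.
move=> Ephi.
pose Q := [set C : set (X -> X) | [/\ C !=set0, ptw_closed C,
  C `<=` [set psi \o phi | psi in env_elt] &
  forall f g, C f -> C g -> C (f \o g)]].
(* Starting from the left ideal generated by [phi] makes the idempotent, once it is the identity, a
   multiple of [phi]. *)
have [||C [[u Cu] clC CE CC] Cmin] := @Zorn_min _ Q [set psi \o phi | psi in env_elt].
- split => //.
  + by exists (id \o phi); exists id => //; exact: env_id.
  + by apply: right_translate_closed; exact: env_closed.
  + move=> _ _ [f Ef <-] [g Eg <-]; exists ((f \o phi) \o g) => //.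
    by do 2 apply: env_comp => //.
- move=> F F0 FQ Ftot; split.
  + by apply: (@chain_ptw_closed _ _ F setT) => //; [exact: ptw_compactT|
      move=> A /FQ[]].
  + by apply: ptw_closed_bigcap => A /FQ[].
  + by case: F0 => A FA x hx; have [_ _ h _] := FQ _ FA; apply: h; exact: hx.
  + by move=> f g hf hg A FA; have [_ _ _ h] := FQ _ FA; apply: h; [exact: hf|exact: hg].
have Eu : env_elt u.
  by have [psi Epsi <-] := CE _ Cu; exact: env_comp.
(* Minimality is used twice: [C u = C] gives some [v] in [C] with [v u = u], then the set of all
   such [v] is [C], so [u u = u]. *)
have CuE : [set v \o u | v in C] = C.
  apply: Cmin; last by move=> _ [v Cv <-]; exact: CC.
  split.
  - by exists (u \o u); exists u.
  - exact: right_translate_closed.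
  - by move=> _ [v Cv <-]; apply: CE; exact: CC.
  - move=> _ _ [v Cv <-] [w Cw <-]; exists ((v \o u) \o w) => //.
    by apply: (CC _ _ _ Cw); exact: (CC _ _ Cv Cu).
have C1E : [set v | C v /\ v \o u = u] = C.
  apply: Cmin; last by move=> v [].
  split.
  - have : [set v \o u | v in C] u by rewrite CuE.
    by move=> [v Cv vu]; exists v.
  - move=> U UU UC s hs; split.
      by apply: (clC U UU _ _ hs); apply: filterS UC => v [].
    apply/funext => x /=.
    apply: (@cvg_unique _ hX ((fun f : X -> X => f (u x)) @ U)); first exact: hs.
    move=> V /nbhs_singleton Vu; change (U (fun v => V (v (u x)))).
    by apply: filterS UC => v [_ vu]; have /= -> := congr1 (@^~ x) vu.
  - by move=> v [Cv _]; exact: CE.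
  - move=> f g [Cf fu] [Cg gu]; split; first exact: CC.
    by rewrite -compA gu.
have [_ uu] : [set v | C v /\ v \o u = u] u by rewrite C1E.
have u1 : u = id.
  by apply/funext => x; apply: (env_inj Eu); exact: (congr1 (fun f => f x) uu).
have [psi Epsi e] := CE _ Cu; exists psi => //.
by rewrite e.
Qed.

Lemma env_inverse phi : env_elt phi ->
  exists psi, [/\ env_elt psi, psi \o phi = id & phi \o psi = id].
Proof.
move=> Ephi; have [psi Epsi pp] := env_left_inverse Ephi.
have [chi Echi cp] := env_left_inverse Epsi.
exists psi; split => //.
suff -> : phi = chi by [].
by rewrite -[RHS]/(chi \o id) -pp compA cp.
Qed.

End Ellis.

(** * States and the enveloping semigroup of M(X) *)

Section Limits.
Context {R : realType} {S : Type} {F : set_system S} {PF : ProperFilter F}.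
Implicit Types (f g : S -> R) (a b : R).

Lemma lim_le f g a b : f @ F --> a -> g @ F --> b -> F [set s | f s <= g s] -> a <= b.
Proof.
move=> fa gb fg; rewrite -subr_ge0.
apply: (@cvgr_to_ge _ F _ _ (fun s => g s - f s)); first exact: (cvgB gb fa).
by apply: filterS fg => s /=; rewrite subr_ge0.
Qed.

Lemma lim_eq f g a b : f @ F --> a -> g @ F --> b -> F [set s | f s = g s] -> a = b.
Proof.
move=> fa gb fg; apply/eqP; rewrite eq_le; apply/andP; split.
  by apply: lim_le fa gb _; apply: filterS fg => s /= ->.
by apply: lim_le gb fa _; apply: filterS fg => s /= ->.
Qed.

Lemma lim_sum (T : Type) (r : seq T) (f : T -> S -> R) (a : T -> R) :
  (forall t, f t @ F --> a t) ->
  (fun s => \sum_(t <- r) f t s) @ F --> \sum_(t <- r) a t.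
Proof.
move=> h; elim: r => [|t r IH].
  rewrite big_nil (_ : (fun s => _) = cst 0); first exact: cvg_cst.
  by apply/funext => s; rewrite big_nil.
rewrite big_cons (_ : (fun s => _) = (fun s => f t s + \sum_(t <- r) f t s)).
  exact: (cvgD (h t) IH).
by apply/funext => s; rewrite big_cons.
Qed.
End Limits.

Section ContinuousReal.
Context {R : realType} {X : topologicalType}.
Implicit Types f g : X -> R.

Lemma ctsD f g : continuous f -> continuous g -> continuous (fun x => f x + g x).
Proof. by move=> cf cg x; exact: (cvgD (cf x) (cg x)). Qed.

Lemma ctsB f g : continuous f -> continuous g -> continuous (fun x => f x - g x).
Proof. by move=> cf cg x; exact: (cvgB (cf x) (cg x)). Qed.

Lemma ctsM f g : continuous f -> continuous g -> continuous (fun x => f x * g x).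
Proof. by move=> cf cg x; exact: (cvgM (cf x) (cg x)). Qed.

Lemma ctsC (a : R) : continuous (fun _ : X => a).
Proof. by move=> x; exact: cvg_cst. Qed.

Lemma ctsZ a f : continuous f -> continuous (fun x => a * f x).
Proof. by move=> cf; apply: ctsM => //; exact: ctsC. Qed.

Lemma ctsN f : continuous f -> continuous (fun x => - f x).
Proof. by move=> cf x; exact: (cvgN (cf x)). Qed.

Lemma ctsA f : continuous f -> continuous (fun x => `|f x|).
Proof. by move=> cf x; exact: (cvg_norm (cf x)). Qed.

Lemma cts_comp (Y : topologicalType) (f : X -> Y) (g : Y -> R) :
  continuous f -> continuous g -> continuous (fun x => g (f x)).
Proof. by move=> cf cg x; apply: (@continuous_comp _ _ _ f g x); [exact: cf|exact: cg]. Qed.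

Lemma cts_bounded f : compact [set: X] -> continuous f ->
  exists2 B, 0 < B & forall x, `|f x| <= B.
Proof.
move=> cX cf.
have /compact_bounded[M [Mr hM]] : compact (f @` [set: X]).
  by apply: continuous_compact => //; exact: continuous_subspaceT.
exists (`|M| + 1); first by rewrite ltr_wpDl.
move=> x; apply: (hM (`|M| + 1) _ (f x)); last by exists x.
by rewrite (le_lt_trans (ler_norm _))// ltrDl.
Qed.
End ContinuousReal.

Section States.
Context {R : realType} {X : topologicalType}.
Implicit Types (f g : X -> R) (L : (X -> R) -> R).

(** By Riesz these are the points of M(X). Values at discontinuous functions are unconstrained, so
    states are compared only on continuous ones. *)
Definition state L := [/\
  forall f g, continuous f -> continuous g -> L (fun x => f x + g x) = L f + L g,
  forall a f, continuous f -> L (fun x => a * f x) = a * L f,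
  forall f, continuous f -> (forall x, 0 <= f x) -> 0 <= L f &
  L (fun=> 1) = 1].

Definition evaluation (x : X) : (X -> R) -> R := fun f => f x.

Lemma state_evaluation x : state (evaluation x).
Proof. by split=> // f _ f0; rewrite /evaluation. Qed.

Section StateTheory.
Context (L : (X -> R) -> R) (sL : state L).

Lemma stateD f g : continuous f -> continuous g -> L (fun x => f x + g x) = L f + L g.
Proof. by case: sL => h _ _ _; exact: h. Qed.

Lemma stateZ a f : continuous f -> L (fun x => a * f x) = a * L f.
Proof. by case: sL => _ h _ _; exact: h. Qed.

Lemma state_ge0 f : continuous f -> (forall x, 0 <= f x) -> 0 <= L f.
Proof. by case: sL => _ _ h _; exact: h. Qed.

Lemma state_cst a : L (fun=> a) = a.
Proof.
case: sL => _ h _ h1; have := h a (fun=> 1) (@ctsC _ _ _).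
by rewrite h1 mulr1 => {2}<-; congr L; apply/funext => x; rewrite mulr1.
Qed.

Lemma stateN f : continuous f -> L (fun x => - f x) = - L f.
Proof.
move=> cf; rewrite -mulN1r -stateZ//; congr L; apply/funext => x.
by rewrite mulN1r.
Qed.

Lemma stateB f g : continuous f -> continuous g -> L (fun x => f x - g x) = L f - L g.
Proof. by move=> cf cg; rewrite stateD ?stateN//; exact: ctsN. Qed.

Lemma state_le f g : continuous f -> continuous g -> (forall x, f x <= g x) -> L f <= L g.
Proof.
move=> cf cg fg; rewrite -subr_ge0 -stateB//; apply: state_ge0; first exact: ctsB.
by move=> x; rewrite subr_ge0.
Qed.

Lemma state_le_cst f a : continuous f -> (forall x, f x <= a) -> L f <= a.
Proof. by move=> cf fa; rewrite -[leRHS]state_cst; apply: state_le => //; exact: ctsC. Qed.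

Lemma state_abs f : continuous f -> `|L f| <= L (fun x => `|f x|).
Proof.
move=> cf; rewrite ler_norml lerNl -stateN//; apply/andP; split; apply: state_le => //.
- exact: ctsN.
- exact: ctsA.
- by move=> x; rewrite -normrN ler_norm.
- exact: ctsA.
- by move=> x; rewrite ler_norm.
Qed.

Lemma state_bound f B : continuous f -> (forall x, `|f x| <= B) -> `|L f| <= B.
Proof.
by move=> cf fB; apply: (le_trans (state_abs cf)); apply: state_le_cst => //; exact: ctsA.
Qed.

Lemma state_cauchy_schwarz f g : continuous f -> continuous g ->
  L (fun x => f x * g x) ^+ 2 <= L (fun x => f x ^+ 2) * L (fun x => g x ^+ 2).
Proof.
move=> cf cg.
have cfg := ctsM cf cg; have cff := ctsM cf cf; have cgg := ctsM cg cg.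
set A := L (fun x => f x ^+ 2); set C := L (fun x => g x ^+ 2).
set B := L (fun x => f x * g x).
have AE : L (fun x => f x * f x) = A by congr L; apply/funext => x; rewrite expr2.
have CE : L (fun x => g x * g x) = C by congr L; apply/funext => x; rewrite expr2.
have h s t : 0 <= s ^+ 2 * A + 2 * s * t * B + t ^+ 2 * C.
  have c1 := ctsZ (a := s ^+ 2) cff; have c2 := ctsZ (a := 2 * s * t) cfg.
  have c3 := ctsZ (a := t ^+ 2) cgg.
  rewrite -AE -CE -!stateZ// -stateD// -stateD//; last exact: ctsD.
  apply: state_ge0 => [|x]; first by apply: ctsD => //; exact: ctsD.
  rewrite (_ : _ + _ = (s * f x + t * g x) ^+ 2) ?sqr_ge0//; ring.
have A0 : 0 <= A by have := h 1 0; rewrite expr1n mul1r mulr0 mul0r addr0 expr0n mul0r addr0.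
have C0 : 0 <= C by have := h 0 1; rewrite expr1n mul1r mulr0 !mul0r expr0n mul0r !add0r.
have [C0'|] := eqVneq C 0.
  rewrite C0' mulr0; have [->|B0] := eqVneq B 0; first by rewrite expr0n.
  (* With [C = 0] the form is affine in its second argument, which is chosen to give the value
     -1. *)
  have := h 1 (- (A + 1) / (2 * B)); rewrite C0' mulr0 addr0.
  rewrite (_ : _ + _ = - 1) ?ler0N1//; by field.
rewrite neq_lt ltNge C0/= => Cp.
(* This choice minimizes the form up to scaling; its value is [C * (A * C - B ^+ 2)]. *)
have h1 := h C (- B).
have : 0 <= C * (A * C - B ^+ 2) by move: h1; nra.
by rewrite pmulr_rge0// subr_ge0.
Qed.
End StateTheory.

Lemma state_lim (S : Type) (F : set_system S) (Ls : S -> (X -> R) -> R) L :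
  ProperFilter F -> F [set s | state (Ls s)] ->
  (forall f, continuous f -> (fun s => Ls s f) @ F --> L f) -> state L.
Proof.
move=> PF sF h; split.
- move=> f g cf cg; apply: (lim_eq (h _ (ctsD cf cg)) (cvgD (h _ cf) (h _ cg))).
  by apply: filterS sF => s sL; rewrite /= stateD.
- move=> a f cf; apply: (lim_eq (h _ (ctsZ cf)) (cvgM (cvg_cst a) (h _ cf))).
  by apply: filterS sF => s sL; rewrite /= stateZ.
- move=> f cf f0; apply: (lim_le (cvg_cst 0) (h _ cf)).
  by apply: filterS sF => s sL; exact: state_ge0.
- have h1 := h _ (@ctsC _ _ (1 : R)).
  have h2 : (fun _ : S => (1 : R)) @ F --> (1 : R) by exact: cvg_cst.
  apply: (lim_eq h1 h2).
  by apply: filterS sF => s sL; exact: state_cst.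
Qed.

(** Weak-star compactness of M(X): the bound on [f] confines all values to a compact interval. *)
Lemma ultra_state (S : Type) (U : set_system S) (Ls : S -> (X -> R) -> R) :
  compact [set: X] -> UltraFilter U -> (forall s, state (Ls s)) ->
  exists2 L, state L & forall f, continuous f -> (fun s => Ls s f) @ U --> L f.
Proof.
move=> cX UU sL.
have h f : exists a : R, continuous f -> (fun s => Ls s f) @ U --> a.
  have [cf|] := pselect (continuous f); last by exists 0.
  have [B B0 fB] := cts_bounded cX cf.
  have [|a _ ha] := @ultra_compact_cvg _ _ U (fun s => Ls s f)
     `[-B, B] UU (@segment_compact _ _ _); last by exists a.
  by apply: filterE => s /=; rewrite in_itv/= -ler_norml; exact: state_bound.
have [L hL] := choice h; exists L => //.
by apply: (@state_lim _ U Ls) => //; exact: filterE.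
Qed.

Lemma state_comp L (phi : X -> X) : continuous phi -> state L ->
  state (fun f => L (fun x => f (phi x))).
Proof.
move=> cphi sL; split.
- by move=> f g cf cg; rewrite stateD//; exact: cts_comp.
- by move=> a f cf; rewrite stateZ//; exact: cts_comp.
- by move=> f cf f0; apply: state_ge0 => //; exact: cts_comp.
- exact: state_cst.
Qed.

Lemma state_sum (T : Type) (r : seq T) (c : T -> R) (M : T -> (X -> R) -> R) :
  (forall t, state (M t)) -> (forall t, 0 <= c t) -> \sum_(t <- r) c t = 1 ->
  state (fun f => \sum_(t <- r) c t * M t f).
Proof.
move=> sM c0 c1; split.
- move=> f g cf cg; rewrite -big_split/=; apply: eq_bigr => t _.
  by rewrite stateD// mulrDr.
- move=> a f cf; rewrite mulr_sumr; apply: eq_bigr => t _.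
  by rewrite stateZ// mulrCA.
- move=> f cf f0; apply: sumr_ge0 => t _; apply: mulr_ge0 => //; exact: state_ge0.
- by rewrite -[RHS]c1; apply: eq_bigr => t _; rewrite state_cst// mulr1.
Qed.
End States.

Section EnvelopingStates.
Context {R : realType} {X : topologicalType} {G : Type}
  (mul : G -> G -> G) (one : G) (act : G -> X -> X).
Implicit Types (f : X -> R) (L : (X -> R) -> R).
Hypothesis hX : hausdorff_space X.
Hypothesis cX : compact [set: X].
Hypothesis act1 : forall x, act one x = x.
Hypothesis actM : forall g h x, act (mul g h) x = act g (act h x).
Hypothesis actC : forall g, continuous (act g).

(* T is a pointwise limit along F of the maps L |-> g L: env_op describes E(M(X)) through states. *)
Definition pushes (F : set_system G) (T : ((X -> R) -> R) -> (X -> R) -> R) :=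
  forall L f, state L -> continuous f ->
    (fun g => L (fun x => f (act g x))) @ F --> T L f.

Definition env_op T := exists2 F : set_system G, ProperFilter F & pushes F T.

Lemma pushes_state F T : ProperFilter F -> pushes F T ->
  forall L, state L -> state (T L).
Proof.
move=> PF pT L sL.
apply: (@state_lim _ _ _ F (fun g f => L (fun x => f (act g x)))).
  by apply: filterE => g; exact: state_comp.
by move=> f cf; exact: pT.
Qed.

Lemma env_op_state T : env_op T -> forall L, state L -> state (T L).
Proof. by move=> [F PF]; exact: pushes_state. Qed.

Lemma env_op_id : env_op id.
Proof.
exists (principal_filter one); first exact: principal_filter_proper.
move=> L f sL cf V /nbhs_singleton LV; apply/principal_filterP => /=.
by rewrite (_ : (fun x => _) = f)//; apply/funext => x; rewrite act1.
Qed.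

Lemma env_op_comp T T' : env_op T -> env_op T' -> env_op (T \o T').
Proof.
move=> [F PF hF] [F' PF' hF'].
exists (filter_bind F (fun g => [set A | F' (fun h => A (mul g h))])).
  exact: filter_bind_proper.
move=> L f sL cf V; rewrite nbhsE => -[W [oW Wx] WV].
have sT'L : state (T' L) by apply: pushes_state hF' _ sL.
have h : F (fun g => W (T' L (fun x => f (act g x)))).
  by apply: (hF _ _ sT'L cf); exact: open_nbhs_nbhs.
apply: filterS h => g Wg.
have cfg : continuous (fun x => f (act g x)) by exact: cts_comp.
have h' := hF' _ _ sL cfg W (open_nbhs_nbhs (conj oW Wg)).
apply: (@filterS _ F' _ _ _ _ h') => y /= /WV.
by under eq_fun do rewrite -actM.
Qed.

(** Along one ultrafilter the translations converge on states and on points; the pair [T], [phi]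
    exhibits the natural map from E(M(X)) to E(X). *)
Lemma ultra_pushes (U : set_system G) : UltraFilter U ->
  exists2 T, pushes U T & exists2 phi, env_elt act phi &
    (forall x, (fun g => act g x) @ U --> phi x) /\
    forall x f, continuous f -> T (evaluation x) f = f (phi x).
Proof.
move=> UU.
have h L : exists T, state L -> forall f, continuous f ->
    (fun g => L (fun x => f (act g x))) @ U --> (T f : R).
  have [sL|] := pselect (state L); last by exists (fun=> 0).
  have [g|T _ hT] := ultra_state (Ls := fun g f => L (fun x => f (act g x))) cX UU.
    exact: state_comp.
  by exists T.
have [T hT] := choice h.
have h' x : exists y : X, (fun g => act g x) @ U --> y.
  by have [|y _ hy] := @ultra_compact_cvg _ _ U (fun g => act g x) _ UU cX;
    [exact: filterT|exists y].
have [phi hphi] := choice h'.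
exists T; first by move=> L f sL; exact: hT.
exists phi; first by exists U => //; exact: ultra_proper.
split => // x f cf.
have h1 := hT _ (state_evaluation x) _ cf.
have h2 : (fun g => f (act g x)) @ U --> f (phi x).
  by apply: continuous_cvg => //; exact: cf.
by apply: (lim_eq h1 h2); exact: filterE.
Qed.

(** Injectivity of the natural map for functionals: [T] and [T'] have the same image [phi] in
    E(X). *)
Definition injective_env := forall T T' phi, env_op T -> env_op T' ->
  env_elt act phi ->
  (forall x f, continuous f -> T (evaluation x) f = f (phi x)) ->
  (forall x f, continuous f -> T' (evaluation x) f = f (phi x)) ->
  forall L f, state L -> continuous f -> T L f = T' L f.

Hypothesis env_inj : forall phi, env_elt act phi -> injective phi.
Hypothesis injE : injective_env.

(** [T'] is taken over the inverse of the map [phi] below [T]; both composites then lie over the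
    identity, and injectivity applies. *)
Lemma pushes_inverse (U : set_system G) : UltraFilter U ->
  exists T T', [/\ pushes U T, env_op T', 
    forall L f, state L -> continuous f -> T' (T L) f = L f &
    forall L f, state L -> continuous f -> T (T' L) f = L f].
Proof.
move=> UU.
have [T UT [phi Ephi [_ Tphi]]] := ultra_pushes UU.
have [psi [[F PF Fpsi] psiphi phipsi]] := env_inverse hX cX act1 actM actC env_inj Ephi.
have [V [UV FV]] := ultraFilterLemma PF.
have [T' VT' [psi' Epsi' [hpsi' Tpsi']]] := ultra_pushes UV.
have psiE : psi' = psi.
  apply/funext => x; apply: (@cvg_unique _ hX ((fun g => act g x) @ V)).
    exact: hpsi'.
  by move=> W Wx; exact: (FV _ (Fpsi x W Wx)).
have ET : env_op T by exists U => //; exact: ultra_proper.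
have ET' : env_op T' by exists V => //; exact: ultra_proper.
(* [T (evaluation x)] agrees with [evaluation (phi x)] on continuous functions only, so equality of
   the arguments of an operator is replaced by equality along the filter. *)
have Teq x : forall L, state L -> (forall f, continuous f -> L f = f x) ->
    forall f, continuous f -> T L f = f (phi x).
  move=> L sL Lx f cf; rewrite -Tphi//.
  apply: (lim_eq (UT _ _ sL cf) (UT _ _ (state_evaluation x) cf)).
  by apply: filterE => g; rewrite /= Lx//; exact: cts_comp.
have Teq' x : forall L, state L -> (forall f, continuous f -> L f = f x) ->
    forall f, continuous f -> T' L f = f (psi' x).
  move=> L sL Lx f cf; rewrite -Tpsi'//.
  apply: (lim_eq (VT' _ _ sL cf) (VT' _ _ (state_evaluation x) cf)).
  by apply: filterE => g; rewrite /= Lx//; exact: cts_comp.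
exists T, T'; split => //.
- move=> L f sL cf.
  apply: (injE (env_op_comp ET' ET) env_op_id (env_id act1)) => // x {}f {}cf /=.
  rewrite (Teq' (phi x))//.
  + by rewrite psiE; have /= -> := congr1 (@^~ x) psiphi.
  + by apply: env_op_state => //; exact: state_evaluation.
  + by move=> g cg; rewrite Tphi.
- move=> L f sL cf.
  apply: (injE (env_op_comp ET ET') env_op_id (env_id act1)) => // x {}f {}cf /=.
  rewrite (Teq (psi' x))//.
  + by rewrite psiE; have /= -> := congr1 (@^~ x) phipsi.
  + by apply: env_op_state => //; exact: state_evaluation.
  + by move=> g cg; rewrite Tpsi'.
Qed.

End EnvelopingStates.

(** * Precompactness in L2 *)

Section StrongConvergence.
Context {R : realType} {X : topologicalType} {G : Type}
  (mul : G -> G -> G) (one : G) (act : G -> X -> X).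
Implicit Types (f : X -> R) (L nu : (X -> R) -> R).
Hypothesis hX : hausdorff_space X.
Hypothesis cX : compact [set: X].
Hypothesis act1 : forall x, act one x = x.
Hypothesis actM : forall g h x, act (mul g h) x = act g (act h x).
Hypothesis actC : forall g, continuous (act g).
Hypothesis env_inj : forall phi, env_elt act phi -> injective phi.
Hypothesis injE : injective_env (R := R) act.

Lemma density_state L f : state L -> continuous f -> (forall x, 0 <= f x) -> 0 < L f ->
  state (fun psi => L (fun x => psi x * f x) / L f).
Proof.
move=> sL cf f0 Lf0; split.
- move=> g h cg ch; rewrite -mulrDl -stateD//; try exact: ctsM.
  by congr (L _ / _); apply/funext => x; rewrite mulrDl.
- move=> a g cg; rewrite mulrA -stateZ//; last exact: ctsM.
  by congr (L _ / _); apply/funext => x; rewrite mulrA.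
- move=> g cg g0; apply: divr_ge0; last exact: ltW.
  by apply: state_ge0 => //; [exact: ctsM|move=> x; exact: mulr_ge0].
- rewrite (_ : (fun x => 1 * f x) = f) ?divff ?gt_eqF//.
  by apply/funext => x; rewrite mul1r.
Qed.

(* If mu = p nu and q inverts p, then the state eta = q (f mu / mu f) is bounded in L2(nu) by
   mu(f^2)^(1/2) / mu f, while eta (f o g) tends to mu(f^2) / mu f: the parallelogram law turns this into an L2
   Cauchy property. *)
Lemma ultra_L2_cauchy (U : set_system G) nu f e : UltraFilter U -> state nu ->
  continuous f -> (forall x, 1 <= f x) -> 0 < e ->
  exists2 A, U A & forall g h, A g -> A h ->
    nu (fun x => (f (act g x) - f (act h x)) ^+ 2) <= e.
Proof.
move=> UU snu cf f1 e0.
have [T [T' [UT ET' T'T TT']]] := pushes_inverse hX cX act1 actM actC env_inj injE UU.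
have PU : ProperFilter U by exact: ultra_proper.
have smu : state (T nu) := pushes_state actC PU UT snu.
have f0 x : 0 <= f x by apply: le_trans (f1 x).
have cff : continuous (fun x => f x ^+ 2) by exact: ctsM.
set m1 := T nu f; set m2 := T nu (fun x => f x ^+ 2).
have m1_ge1 : 1 <= m1 by rewrite -(state_cst smu 1); apply: state_le => //; exact: ctsC.
have m12 : m1 <= m2 by apply: state_le => // x; rewrite expr2 ler_peMr.
have m1p : 0 < m1 by apply: lt_le_trans m1_ge1.
have m2p : 0 < m2 by apply: lt_le_trans m12.
pose kappa := fun psi => T nu (fun x => psi x * f x) / m1.
have skappa : state kappa by exact: density_state.
have seta : state (T' kappa) := env_op_state actC ET' skappa.
(* Cauchy-Schwarz for [T nu] against the weight [f], then a limit along the filter of [T'], which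
   brings [T nu] back to [nu]. *)
have contr psi : continuous psi ->
    T' kappa psi ^+ 2 <= m2 / m1 ^+ 2 * nu (fun x => psi x ^+ 2).
  move=> cpsi; have cpp : continuous (fun x => psi x ^+ 2) by exact: ctsM.
  have [F PF hF] := ET'.
  have h1 := hF _ _ skappa cpsi; have h2 := hF _ _ smu cpp.
  rewrite T'T// in h2.
  have h3 : (fun g => kappa (fun x => psi (act g x)) ^+ 2) @ F --> T' kappa psi ^+ 2.
    exact: (cvgM h1 h1).
  have h4 : (fun g => m2 / m1 ^+ 2 * T nu (fun x => psi (act g x) ^+ 2)) @ F -->
      m2 / m1 ^+ 2 * nu (fun x => psi x ^+ 2).
    exact: (cvgM (cvg_cst _) h2).
  apply: (lim_le h3 h4); apply: filterE => g /=.
  have cpg : continuous (fun x => psi (act g x)) by exact: cts_comp.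
  have := state_cauchy_schwarz smu cpg cf.
  rewrite -/m2 => h; rewrite /kappa expr_div_n [leRHS]mulrAC.
  by rewrite ler_pM2r ?invr_gt0 ?exprn_gt0// mulrC.
(* The parallelogram law will end in the bound [4 * d * (1 + 2 * m1)]; [d <= 1 <= m2 / m1] allows
   squaring the lower bound. *)
pose d := Num.min 1 (e / (4 * (1 + 2 * m1))).
have d0 : 0 < d by rewrite lt_min ltr01/= divr_gt0// mulr_gt0// addr_gt0// mulr_gt0.
have d1 : d <= 1 by rewrite ge_min lexx.
have de : 4 * d * (1 + 2 * m1) <= e.
  have : d <= e / (4 * (1 + 2 * m1)) by rewrite ge_min lexx orbT.
  rewrite ler_pdivlMr; last by rewrite mulr_gt0// addr_gt0// mulr_gt0.
  by rewrite mulrA (mulrC d).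
exists ([set g | m2 / m1 - d < T' kappa (fun x => f (act g x))] `&`
        [set g | nu (fun x => f (act g x) ^+ 2) < m2 + d]).
  apply: filterI.
  - have := UT _ _ seta cf; rewrite TT'// => /cvgrPdist_lt/(_ _ d0).
    apply: filterS => g /=.
    rewrite /kappa (_ : (fun x => f x * f x) = (fun x => f x ^+ 2)) -/m2//.
    by rewrite ltr_norml => /andP[_]; rewrite ltrBlDr ltrBlDl addrC.
  - have := UT _ _ snu cff => /cvgrPdist_lt/(_ _ d0).
    apply: filterS => g /=; rewrite -/m2.
    by rewrite ltr_norml => /andP[+ _]; rewrite ltrNl opprB ltrBlDl.
move=> g h [/= Ag Bg] [/= Ah Bh].
have cfg : continuous (fun x => f (act g x)) by exact: cts_comp.
have cfh : continuous (fun x => f (act h x)) by exact: cts_comp.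
have cgg := ctsM cfg cfg; have chh := ctsM cfh cfh.
have cgh := ctsB cfg cfh; have cgh2 := ctsM cgh cgh.
set u := fun x => f (act g x) in Ag Bg cfg cgg cgh cgh2 *.
set v := fun x => f (act h x) in Ah Bh cfh chh cgh cgh2 *.
have cpsi : continuous (fun x => 2^-1 * (u x + v x)) by apply: ctsZ; exact: ctsD.
have h1 := contr _ cpsi.
rewrite stateZ// in h1; last exact: ctsD.
rewrite stateD// in h1.
rewrite (_ : (fun x => (2^-1 * (u x + v x)) ^+ 2) =
  (fun x => 2^-1 * (u x * u x) + 2^-1 * (v x * v x) - 4^-1 * ((u x - v x) * (u x - v x)))) in h1; last first.
  by apply/funext => x; field.
rewrite stateB ?stateD ?stateZ// in h1; try exact: ctsZ; last first.
  by apply: ctsD; exact: ctsZ.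
rewrite (_ : (fun x => (f (act g x) - f (act h x)) ^+ 2) = (fun x => (u x - v x) * (u x - v x)))//.
set q := nu _; rewrite -/q in h1.
rewrite (_ : (fun x => f (act g x) ^+ 2) = (fun x => u x * u x))// in Bg.
rewrite (_ : (fun x => f (act h x) ^+ 2) = (fun x => v x * v x))// in Bh.
set a := nu (fun x => u x * u x) in h1 Bg; set b := nu (fun x => v x * v x) in h1 Bh.
set s := T' kappa u in h1 Ag; set t := T' kappa v in h1 Ah.
have h2 : (m2 / m1 - d) ^+ 2 <= (2^-1 * (s + t)) ^+ 2.
  rewrite ler_sqr ?nnegrE; try lra.
  - have : 1 <= m2 / m1 by rewrite ler_pdivlMr// mul1r.
    lra.
  - have : 1 <= m2 / m1 by rewrite ler_pdivlMr// mul1r.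
    lra.
have h3 := le_trans h2 h1.
have h4 : (m2 - d * m1) ^+ 2 <= m2 * (2^-1 * a + 2^-1 * b - 4^-1 * q).
  have -> : (m2 - d * m1) ^+ 2 = (m2 / m1 - d) ^+ 2 * m1 ^+ 2.
    by field; rewrite gt_eqF.
  apply: le_trans (_ : _ <= m2 / m1 ^+ 2 * (2^-1 * a + 2^-1 * b - 4^-1 * q) * m1 ^+ 2) _.
    by rewrite ler_pM2r ?exprn_gt0.
  by rewrite le_eqVlt; apply/orP; left; apply/eqP; field; rewrite gt_eqF.
have h5 : m2 * (m2 - 2 * d * m1) <= m2 * (2^-1 * a + 2^-1 * b - 4^-1 * q).
  apply: le_trans h4; have := sqr_ge0 (d * m1); nra.
rewrite ler_pM2l// in h5.
apply: le_trans de; lra.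
Qed.

(** An ultrafilter finer than the tails of [g] gives two indices at squared L2 distance at most
    [k ^+ 2 / 2], and for a probability the squared L1 distance is no larger. Adding [B + 1] to [f]
    makes it at least 1 and leaves differences unchanged. *)
Lemma not_separated nu f (g : nat -> G) k : state nu -> continuous f -> 0 < k ->
  ~ (forall i j, (i < j)%N -> k <= nu (fun x => `|f (act (g i) x) - f (act (g j) x)|)).
Proof.
move=> snu cf k0 sep.
have [B B0 fB] := cts_bounded cX cf.
pose f' := fun x => f x + (B + 1).
have cf' : continuous f' by apply: ctsD => //; exact: ctsC.
have f'1 x : 1 <= f' x.
  by rewrite /f' addrA lerDr -lerBlDr sub0r lerNl (le_trans _ (fB x))// -normrN ler_norm.
have [U [UU gU]] := @ultraFilterLemma _ (g @ \oo) _.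
have e0 : 0 < k ^+ 2 / 2 by rewrite divr_gt0// exprn_gt0.
have [A UA hA] := ultra_L2_cauchy UU snu cf' f'1 e0.
have inf N : exists2 n, (N <= n)%N & A (g n).
  apply: contrapT => h.
  have : U (~` A).
    apply: gU; exists N => // n /= Nn An; apply: h; by exists n.
  by move=> nA; have /filter_ex[x [//]] : U (A `&` ~` A) by exact: filterI.
have [i _ Ai] := inf 0%N.
have [j ij Aj] := inf i.+1.
have := hA _ _ Ai Aj; have := sep _ _ ij.
pose u x := f (act (g i) x) - f (act (g j) x).
rewrite (_ : (fun x => (f' _ - _) ^+ 2) = (fun x => u x ^+ 2)); last first.
  by apply/funext => x; rewrite /f' /u; ring.
rewrite -[X in nu X]/(fun x => `|u x|) => h1 h2.
have cu : continuous u by apply: ctsB; exact: cts_comp.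
have := state_cauchy_schwarz snu (ctsA cu) (@ctsC _ _ (1 : R)).
rewrite (_ : (fun x => `|u x| * 1) = (fun x => `|u x|)); last first.
  by apply/funext => x; rewrite mulr1.
rewrite (_ : (fun x => `|u x| ^+ 2) = (fun x => u x ^+ 2)); last first.
  by apply/funext => x; rewrite real_normK ?num_real.
rewrite (state_cst snu) expr1n mulr1 => h3.
have h4 : k ^+ 2 <= nu (fun x => `|u x|) ^+ 2 by rewrite ler_sqr ?nnegrE//; lra.
have : k ^+ 2 <= k ^+ 2 / 2 by apply: le_trans h4 (le_trans h3 h2).
have : 0 < k ^+ 2 by rewrite exprn_gt0.
lra.
Qed.
End StrongConvergence.

(** * A mean fixed by the stabilizer of a dense set *)

Section FixedMean.
Context {R : realType} {X : topologicalType} {G : Type}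
  (mul : G -> G -> G) (one : G) (act : G -> X -> X).
Implicit Types (f : X -> R) (L nu : (X -> R) -> R) (s : X * (X -> R) -> R).
Hypothesis hX : hausdorff_space X.
Hypothesis cX : compact [set: X].
Hypothesis act1 : forall x, act one x = x.
Hypothesis actM : forall g h x, act (mul g h) x = act g (act h x).
Hypothesis actC : forall g, continuous (act g).
Hypothesis env_inj : forall phi, env_elt act phi -> injective phi.
Hypothesis injE : injective_env (R := R) act.

(** [N] stands for the neighbourhoods of the identity; [NM] is continuity of the product there in
    iterated form, [g] being restricted only after [h] is given. *)
Context (N : set_system G).
Hypothesis N1 : forall O, N O -> O one.
Hypothesis NM : forall O, N O -> N [set h | N [set g | O (mul h g)]].

(** The value 0 at discontinuous functions is a normalization that lets families be compared by
    plain equality; the uncurried form makes them points of a product. *)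
Definition state_family s :=
  (forall x, state (fun f => s (x, f))) /\
  (forall x f, ~ continuous f -> s (x, f) = 0).

(* By Hahn-Banach, this says that s is a limit of averages of translations g in O, for each O in N. *)
Definition local_mean s := state_family s /\
  forall O, N O -> forall (ps : seq (X * {f : X -> R | continuous f})) (B : R),
    (forall g, O g -> \sum_(p <- ps) sval p.2 (act g p.1) <= B) ->
    \sum_(p <- ps) s (p.1, sval p.2) <= B.

(* s' is the image of s under an element of the enveloping semigroup which is a limit along N. *)
Definition reach s s' := state_family s' /\
  exists2 F : set_system G, ProperFilter F & N `<=` F /\
    forall x f, continuous f -> (fun h => s (x, fun y => f (act h y))) @ F --> s' (x, f).

Lemma state_family_compact : ptw_compact state_family.
Proof.
move=> U UU UK.
have h (p : X * (X -> R)) : exists a : R, (fun s => s p) @ U --> a.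
  case: p => x f; have [cf|ncf] := pselect (continuous f); last first.
    exists 0; apply: cvg_near_cst.
    by apply: filterS UK => s [_ h]; exact: h.
  have [B B0 fB] := cts_bounded cX cf.
  have [|a _ ha] := @ultra_compact_cvg _ _ U (fun s => s (x, f))
     `[-B, B] UU (@segment_compact _ _ _).
    apply: filterS UK => s [h _] /=; rewrite in_itv/= -ler_norml.
    exact: (state_bound (h x)).
  by exists a.
by have [s hs] := choice h; exists s.
Qed.

Lemma state_family_closed : ptw_closed state_family.
Proof.
move=> U UU UK s hs.
split=> [x|x f ncf].
  apply: (@state_lim _ _ _ U (fun (t : X * (X -> R) -> R) f => t (x, f))).
    by apply: filterS UK => t [h _]; exact: h.
  by move=> f cf; exact: hs.
apply: (lim_eq (hs (x, f)) (cvg_cst 0)).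
by apply: filterS UK => t [_ h]; exact: h.
Qed.

Lemma local_mean_closed : ptw_closed local_mean.
Proof.
move=> U UU UK s hs; split.
  by apply: (state_family_closed UU _ hs); apply: filterS UK => t [].
move=> O NO ps B hB.
have PU : ProperFilter U by exact: ultra_proper.
have h1 := @lim_sum R _ U PU _ ps _ _ (fun p => hs (p.1, sval p.2)).
have h2 : (fun _ : X * (X -> R) -> R => B) @ U --> B by exact: cvg_cst.
apply: (lim_le h1 h2); apply: filterS UK => t [_ h] /=.
exact: h NO _ _ hB.
Qed.

Lemma state_family_mid s t : state_family s -> state_family t ->
  state_family (fun p => 2^-1 * (s p + t p)).
Proof.
move=> [s1 s2] [t1 t2]; split=> [x|x f ncf]; last by rewrite s2// t2// addr0 mulr0.
split.
- by move=> f g cf cg; rewrite (stateD (s1 x))// (stateD (t1 x))//; ring.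
- by move=> a f cf; rewrite (stateZ (s1 x))// (stateZ (t1 x))//; ring.
- move=> f cf f0; apply: mulr_ge0 => //.
  by apply: addr_ge0; [exact: (state_ge0 (s1 x))|exact: (state_ge0 (t1 x))].
- by rewrite (state_cst (s1 x)) (state_cst (t1 x)); field.
Qed.

Lemma local_mean_mid s t : local_mean s -> local_mean t ->
  local_mean (fun p => 2^-1 * (s p + t p)).
Proof.
move=> [s1 s2] [t1 t2]; split; first exact: state_family_mid.
move=> O NO ps B hB; have := s2 _ NO _ _ hB; have := t2 _ NO _ _ hB.
rewrite -mulr_sumr big_split/= => *; lra.
Qed.

(** For most [h], a translation [g] in the smaller set has [mul h g] in [O]; [tr] shifts [h] onto
    the test functions. *)
Lemma local_mean_reach s s' : local_mean s -> reach s s' -> local_mean s'.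
Proof.
move=> [_ hs] [fs' [F PF [NF hF]]]; split => //.
move=> O NO ps B hB.
have h1 := @lim_sum R _ F PF _ ps _ _ (fun p => hF p.1 _ (svalP p.2)).
have h2 : (fun _ : G => B) @ F --> B by exact: cvg_cst.
apply: (lim_le h1 h2); apply: filterS (NF _ (NM NO)) => h /= Oh.
pose tr (p : X * {f : X -> R | continuous f}) : X * {f : X -> R | continuous f} :=
  (p.1, exist _ (fun y => sval p.2 (act h y)) (cts_comp (@actC h) (svalP p.2))).
have := hs _ Oh [seq tr p | p <- ps] B; rewrite !big_map/=; apply.
move=> g Og; rewrite big_map/=; under eq_bigr do rewrite -actM.
exact: hB.
Qed.

Definition unit_mean : X * (X -> R) -> R :=
  fun p => if pselect (continuous p.2) then p.2 p.1 else 0.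

Lemma unit_meanE x f : continuous f -> unit_mean (x, f) = f x.
Proof. by move=> cf; rewrite /unit_mean/=; case: pselect. Qed.

Lemma local_mean_unit : local_mean unit_mean.
Proof.
split; [split=> [x|x f ncf]|].
- split.
  + by move=> f g cf cg; rewrite !unit_meanE//; exact: ctsD.
  + by move=> a f cf; rewrite !unit_meanE//; exact: ctsZ.
  + by move=> f cf f0; rewrite unit_meanE.
  + by rewrite unit_meanE//; exact: ctsC.
- by rewrite /unit_mean; case: pselect.
- move=> O NO ps B hB; have := hB _ (N1 NO).
  rewrite (eq_bigr (fun p => unit_mean (p.1, sval p.2)))//.
  by move=> [x [f cf]] _; rewrite unit_meanE//= act1.
Qed.

(** Nonempty closed convex invariant sets; convexity is asked for midpoints, as in the parallelogram
    identity below. *)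
Definition invariant_means := [set C : set (X * (X -> R) -> R) | [/\
  C !=set0, ptw_closed C, C `<=` local_mean,
  forall s t, C s -> C t -> C (fun p => 2^-1 * (s p + t p)) &
  forall s s', C s -> reach s s' -> C s']].

Lemma minimal_invariant_means : exists2 C, invariant_means C &
  forall C', invariant_means C' -> C' `<=` C -> C' = C.
Proof.
apply: (@Zorn_min _ invariant_means local_mean).
  split => //.
  - by exists unit_mean; exact: local_mean_unit.
  - exact: local_mean_closed.
  - exact: local_mean_mid.
  - exact: local_mean_reach.
move=> F F0 FQ Ftot; split.
- apply: (chain_ptw_closed state_family_compact) => // A FA.
  by have [An Ac AK _ _] := FQ _ FA; split => // s /AK[].
- by apply: ptw_closed_bigcap => A /FQ[].
- by case: F0 => A FA s hs; have [_ _ h _ _] := FQ _ FA; apply: h; exact: hs.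
- move=> s t hs ht A FA; have [_ _ _ h _] := FQ _ FA.
  by apply: h; [exact: hs|exact: ht].
- move=> s s' hs ss' A FA; have [_ _ _ _ h] := FQ _ FA.
  by apply: h ss'; exact: hs.
Qed.

(** * Strict convexity on a minimal invariant set *)

Section Energy.
Context (x : X) (fs : seq {f : X -> R | continuous f}).

Definition energy s g := \sum_(f <- fs) s (x, fun y => sval f (act g y)) ^+ 2.

Lemma energy_bound : exists B, forall s g, state_family s -> energy s g <= B.
Proof.
rewrite /energy; elim: fs => [|[f cf] r [B hB]].
  by exists 0 => s g _; rewrite big_nil.
have [B' B'0 fB'] := cts_bounded cX cf.
exists (B' ^+ 2 + B) => s g hs; rewrite big_cons lerD ?hB//=.
rewrite -real_normK ?num_real// ler_sqr ?nnegrE//; last exact: ltW.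
by apply: (state_bound (hs.1 x)) => //; exact: cts_comp.
Qed.

(** Sublevel sets of the supremum over [g] of a convex continuous function are closed, convex and
    invariant: [reach] makes [energy v g] a limit of [energy u (mul g h)]. By minimality that
    supremum is constant on [C]. *)
Lemma energy_sublevel C b : invariant_means C ->
  (forall C', invariant_means C' -> C' `<=` C -> C' = C) ->
  forall s, C s -> (forall g, energy s g <= b) -> forall t, C t -> forall g, energy t g <= b.
Proof.
move=> [C0 Ccl CP Cmid Creach] Cmin s Cs hs t Ct.
suff E : [set t | C t /\ forall g, energy t g <= b] = C.
  by move: Ct; rewrite -E => -[].
apply: Cmin; last by move=> u [].
split.
- by exists s.
- move=> U UU UC u hu; split.
    by apply: (Ccl U UU _ _ hu); apply: filterS UC => v [].
  move=> g.
  have h1 : (fun v => energy v g) @ U --> energy u g.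
    by apply: lim_sum => f; exact: (cvgM (hu _) (hu _)).
  have h2 : (fun _ : X * (X -> R) -> R => b) @ U --> b by exact: cvg_cst.
  by apply: (lim_le h1 h2); apply: filterS UC => v [_]; exact.
- by move=> u [/CP].
- move=> u v [Cu hu] [Cv hv]; split; first exact: Cmid.
  move=> g; have := hu g; have := hv g; rewrite /energy => hv' hu'.
  suff : \sum_(f <- fs) (2^-1 * (u (x, fun y => sval f (act g y)) + v (x, fun y => sval f (act g y)))) ^+ 2
    <= 2^-1 * \sum_(f <- fs) u (x, fun y => sval f (act g y)) ^+ 2 +
       2^-1 * \sum_(f <- fs) v (x, fun y => sval f (act g y)) ^+ 2 by lra.
  rewrite !mulr_sumr -big_split/=; apply: ler_sum => f _.
  have := sqr_ge0 (u (x, fun y => sval f (act g y)) - v (x, fun y => sval f (act g y))).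
  by nra.
- move=> u v [Cu hu] uv; split; first exact: Creach uv.
  move=> g; have [_ [F PF [_ hF]]] := uv.
  have h1 : (fun h => energy u (mul g h)) @ F --> energy v g.
    apply: lim_sum => f; have := hF x (fun y => sval f (act g y)) (cts_comp (@actC g) (svalP f)).
    under eq_fun do under [fun y => _]eq_fun do rewrite -actM.
    by move=> h; exact: (cvgM h h).
  have h2 : (fun _ : G => b) @ F --> b by exact: cvg_cst.
  by apply: (lim_le h1 h2); apply: filterE => h; exact: hu.
Qed.

(** If all translates of [a] and [b] stayed [e] apart, their midpoint would have energy at most
    [sup A - 4^-1 * e] everywhere; by [energy_sublevel] so would [a], against the choice of
    [sup A]. *)
Lemma energy_proximal C : invariant_means C ->
  (forall C', invariant_means C' -> C' `<=` C -> C' = C) ->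
  forall a b, C a -> C b -> forall e, 0 < e ->
  exists g, \sum_(f <- fs) (a (x, fun y => sval f (act g y)) - b (x, fun y => sval f (act g y))) ^+ 2 < e.
Proof.
move=> IC Cmin a b Ca Cb e e0; apply: contrapT => /forallNP hn.
have {}hn g : e <= \sum_(f <- fs) (a (x, fun y => sval f (act g y)) - b (x, fun y => sval f (act g y))) ^+ 2.
  by rewrite leNgt; apply/negP; exact: hn.
have [_ _ CP Cmid _] := IC.
have [B hB] := energy_bound.
pose A := [set energy a g | g in setT].
have hA : has_sup A.
  split; first by exists (energy a one); exists one.
  by exists B => _ [g _ <-]; apply: hB; have [] := CP _ Ca.
have ha g : energy a g <= sup A by apply: ub_le_sup; [case: hA|exists g].
have hb := energy_sublevel IC Cmin Ca ha Cb.
have hm g : energy (fun p => 2^-1 * (a p + b p)) g <= sup A - 4^-1 * e.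
  have h1 := ha g; have h2 := hb g; have h3 := hn g.
  rewrite (_ : energy _ g = 2^-1 * energy a g + 2^-1 * energy b g - 4^-1 * 
   \sum_(f <- fs) (a (x, fun y => sval f (act g y)) - b (x, fun y => sval f (act g y))) ^+ 2); first by lra.
  by rewrite /energy !mulr_sumr -big_split/= -sumrB; apply: eq_bigr => f _; field.
have h := energy_sublevel IC Cmin (Cmid _ _ Ca Cb) hm Ca.
have [_ [g _ <-]] : exists2 c, A c & sup A - 4^-1 * e < c.
  by apply: sup_adherent => //; rewrite mulr_gt0.
by rewrite ltNge h.
Qed.
End Energy.

(* Two points of a minimal invariant convex set are proximal by strict convexity, hence equal by distality of M(X). *)
Lemma fixed_mean : exists2 M, local_mean M &
  forall M', reach M M' -> M' = M.
Proof.
have [C IC Cmin] := minimal_invariant_means.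
have [[M CM] _ CP _ Creach] := IC.
suff E a b : C a -> C b -> a = b.
  exists M; first exact: CP.
  by move=> M' /(Creach _ _ CM) CM'; exact: E.
move=> Ca Cb; apply/funext => -[x f].
have [[fa za] _] := CP _ Ca; have [[fb zb] _] := CP _ Cb.
have [cf|ncf] := pselect (continuous f); last by rewrite za// zb.
pose D (fs : seq {f : X -> R | continuous f}) e := [set g | 
  \sum_(f <- fs) (a (x, fun y => sval f (act g y)) - b (x, fun y => sval f (act g y))) ^+ 2 < e].
(* This filter is proper by [energy_proximal]; along it the translates of [a] and [b] at [x]
   merge. *)
pose F := [set A : set G | exists fs e, 0 < e /\ D fs e `<=` A].
have PF : ProperFilter F.
  apply: Build_ProperFilter_ex.
    move=> A [fs [e [e0 DA]]].
    by have [g hg] := energy_proximal x fs IC Cmin Ca Cb e0; exists g; exact: DA.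
  split.
  - by exists [::], 1.
  - move=> A A' [fs [e [e0 DA]]] [fs' [e' [e'0 DA']]].
    exists (fs ++ fs'), (Num.min e e'); split; first by rewrite lt_min e0.
    move=> g; rewrite /D/= big_cat/= lt_min => /andP[h h'].
    split; [apply: DA; apply: le_lt_trans h|apply: DA'; apply: le_lt_trans h'].
      by rewrite lerDl; apply: sumr_ge0 => i _; exact: sqr_ge0.
    by rewrite lerDr; apply: sumr_ge0 => i _; exact: sqr_ge0.
  - by move=> A A' AA' [fs [e [e0 DA]]]; exists fs, e; split => //; exact: subset_trans AA'.
have [U [UU FU]] := ultraFilterLemma PF.
have [T [T' [UT ET' T'T _]]] := pushes_inverse hX cX act1 actM actC env_inj injE UU.
pose La := fun f => a (x, f); pose Lb := fun f => b (x, f).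
have PU : ProperFilter U by exact: ultra_proper.
(* Proximality becomes equality in the limit [T], and the inverse [T'] carries the equality back. *)
have TE g : continuous g -> T La g = T Lb g.
  move=> cg; apply/eqP; rewrite -subr_eq0 -normr_le0.
  have h1 : (fun h => `|La (fun y => g (act h y)) - Lb (fun y => g (act h y))|) @ U -->
      `|T La g - T Lb g|.
    by apply: cvg_norm; apply: cvgB; [exact: (UT La g (fa x) cg)|exact: (UT Lb g (fb x) cg)].
  apply/ler_addgt0Pr => e e0; rewrite add0r.
  have h2 : (fun _ : G => e) @ U --> e by exact: cvg_cst.
  apply: (lim_le h1 h2); apply: FU; exists [:: exist _ g cg], (e ^+ 2).
  split; first by rewrite exprn_gt0.
  move=> h; rewrite /D/= big_seq1/= -real_normK ?num_real// => h3.
  by apply: ltW; rewrite -(@ltr_pXn2r _ 2)// nnegrE// ltW.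
rewrite -[a _]/(La f) -[b _]/(Lb f) -(T'T La f (fa x) cf) -(T'T Lb f (fb x) cf).
have [F' PF' hF'] := ET'.
have sa := pushes_state actC PU UT (fa x); have sb := pushes_state actC PU UT (fb x).
apply: (lim_eq (hF' _ _ sa cf) (hF' _ _ sb cf)).
by apply: filterE => g /=; apply: TE; exact: cts_comp.
Qed.

End FixedMean.

(** * From precompactness to equicontinuity *)

Lemma filter_ltn (T : Type) (F : set_system T) (n : nat) (P : nat -> set T) :
  Filter F -> (forall i, (i < n)%N -> F (P i)) -> F [set t | forall i, (i < n)%N -> P i t].
Proof.
move=> FF; elim: n => [|n IH] FP; first exact: filterE.
have h1 := IH (fun i ni => FP i (ltnW ni)); have h2 := FP n (ltnSn n).
apply: filterS2 h1 h2 => t h Pn i; rewrite ltnS leq_eqVlt => /predU1P[->//|].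
exact: h.
Qed.

Lemma filter_mem (T : Type) (I : eqType) (F : set_system T) (r : seq I) (P : I -> set T) :
  Filter F -> (forall i, i \in r -> F (P i)) -> F [set t | forall i, i \in r -> P i t].
Proof.
move=> FF; elim: r => [|j r IH] FP; first exact: filterE.
have h1 := IH (fun i ir => FP i (mem_behead (s := j :: r) ir)).
have h2 := FP j (mem_head _ _).
apply: filterS2 h1 h2 => t h Pj i; rewrite inE => /predU1P[->//|].
exact: h.
Qed.

Lemma sum_cst_seq (R : realType) (T : Type) (r : seq T) (c : R) :
  \sum_(x <- r) c = c * (size r)%:R.
Proof.
elim: r => [|x r IH]; first by rewrite big_nil mulr0.
by rewrite big_cons IH /= -natr1 mulrDr mulr1 addrC.
Qed.

Lemma common_lower_bound (R : realType) (n : nat) (a : nat -> R) :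
  (forall i, (i < n)%N -> 0 < a i) ->
  exists2 s, 0 < s & forall i, (i < n)%N -> s <= a i.
Proof.
elim: n => [|n IH] a0; first by exists 1.
have [|s s0 hs] := IH; first by move=> i ni; apply: a0; exact: ltnW.
exists (Num.min s (a n)); first by rewrite lt_min s0 a0.
move=> i; rewrite ltnS leq_eqVlt => /predU1P[->|ni]; rewrite ge_min ?lexx ?orbT//.
by rewrite hs.
Qed.

Lemma common_lower_bound2 (R : realType) (n : nat) (a : nat -> nat -> R) :
  (forall i j, (i < j < n)%N -> 0 < a i j) ->
  exists2 s, 0 < s & forall i j, (i < j < n)%N -> s <= a i j.
Proof.
elim: n => [|n IH] a0; first by exists 1 => // i j; rewrite ltn0 andbF.
have [|s s0 hs] := IH.
  by move=> i j /andP[ij jn]; apply: a0; rewrite ij ltnW.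
have [|t t0 ht] := @common_lower_bound R n (a^~ n).
  by move=> i ni; rewrite a0// ni/=.
exists (Num.min s t); first by rewrite lt_min s0.
move=> i j /andP[ij]; rewrite ltnS leq_eqVlt => /predU1P[jn|jn].
  by rewrite ge_min jn ht ?orbT// -jn.
by rewrite ge_min hs// ij.
Qed.

Section Dynamics.
Context {R : realType} {X : topologicalType} {G : Type}
  (mul : G -> G -> G) (one : G) (inv : G -> G) (act : G -> X -> X).
Implicit Types (f : X -> R) (L nu : (X -> R) -> R) (s : X * (X -> R) -> R).
Hypothesis hX : hausdorff_space X.
Hypothesis cX : compact [set: X].
Hypothesis act1 : forall x, act one x = x.
Hypothesis actM : forall g h x, act (mul g h) x = act g (act h x).
Hypothesis actV : forall g x, act (inv g) (act g x) = x.
Hypothesis actC : forall g, continuous (act g).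
Hypothesis env_inj : forall phi, env_elt act phi -> injective phi.
Hypothesis injE : injective_env (R := R) act.

Context (fsep : nat -> X -> R) (D : nat -> X).
Hypothesis fsepC : forall l, continuous (fsep l).
Hypothesis fsepP : forall x V, nbhs x V ->
  exists l, exists2 d : R, 0 < d & forall y, `|fsep l y - fsep l x| < d -> V y.
Hypothesis Dense : forall V, open V -> V !=set0 -> exists i, V (D i).

Lemma fsep_inj x y : (forall l, fsep l x = fsep l y) -> x = y.
Proof.
move=> E; apply: contrapT => xy.
have [|l [d d0 h]] := @fsepP x (~` [set y]).
  apply: open_nbhs_nbhs; split => //.
  by apply: closed_openC; apply: accessible_closed_set1; exact: hausdorff_accessible.
by apply: (h y) => //; rewrite E subrr normr0.
Qed.

(** Near [x], as measured by a single [fsep l], the function [f] varies by less than [e]; elsewhere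
    its variation is at most [B / d] times that of [fsep l]. *)
Lemma state_dirac L x : state L -> (forall l, L (fun y => `|fsep l y - fsep l x|) <= 0) ->
  forall f, continuous f -> L f = f x.
Proof.
move=> sL hL f cf.
have cfx : continuous (fun y => f y - f x) by apply: ctsB => //; exact: ctsC.
have cl l : continuous (fun y => `|fsep l y - fsep l x|).
  by apply: ctsA; apply: ctsB => //; exact: ctsC.
apply/eqP; rewrite -subr_eq0 -normr_le0.
have -> : L f - f x = L (fun y => f y - f x).
  by rewrite (stateB sL) ?(state_cst sL)//; exact: ctsC.
apply/ler_addgt0Pr => e e0; rewrite add0r.
have [B B0 fB] := cts_bounded cX cfx.
have /fsepP[l [d d0 hd]] : nbhs x [set y | `|f x - f y| < e].
  by have /cvgrPdist_lt/(_ _ e0) := cf x.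
apply: le_trans (state_abs sL cfx) _.
have : L (fun y => `|f y - f x|) <= L (fun y => e + B / d * `|fsep l y - fsep l x|).
  apply: state_le => //; first exact: ctsA.
    by apply: ctsD; [exact: ctsC|exact: ctsZ].
  move=> y; have [h|h] := ltP `|fsep l y - fsep l x| d.
    rewrite distrC (le_trans (ltW (hd y h)))// lerDl mulr_ge0//.
    by rewrite divr_ge0// ltW.
  apply: le_trans (fB y) _; rewrite -[leLHS]add0r lerD//; first exact: ltW.
  by rewrite mulrAC ler_pdivlMr// ler_wpM2l// ltW.
rewrite (stateD sL); [|exact: ctsC|exact: ctsZ].
rewrite (stateZ sL)// (state_cst sL) => /le_trans; apply.
rewrite gerDl; apply: mulr_ge0_le0 => //.
by rewrite divr_ge0// ltW.
Qed.

(* Neighbourhoods of the identity for pointwise convergence on D. *)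
Definition fixD : set_system G := [set O | exists n (V : nat -> set X),
  (forall i, nbhs (D i) (V i)) /\
  forall g, (forall i, (i < n)%N -> V i (act g (D i))) -> O g].

Lemma fixD_filter : Filter fixD.
Proof.
split.
- by exists 0%N, (fun=> setT); split => // i; exact: filterT.
- move=> A B [n [V [hV VA]]] [m [W [hW WB]]].
  exists (maxn n m), (fun i => V i `&` W i); split; first by move=> i; exact: filterI.
  move=> g h; split.
    by apply: VA => i ni; have [] := h i; rewrite // leq_max ni.
  by apply: WB => i ni; have [] := h i; rewrite // leq_max ni orbT.
- move=> A B AB [n [V [hV VA]]]; exists n, V; split => // g h; apply: AB; exact: VA.
Qed.

Lemma fixD_nbhs i V : nbhs (D i) V -> fixD [set g | V (act g (D i))].
Proof.
move=> DV; exists i.+1, (fun j => if j == i then V else setT); split.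
  by move=> j; case: ifPn => [/eqP->//|_]; exact: filterT.
by move=> g /(_ i (ltnSn i)); rewrite eqxx.
Qed.

Lemma fixD1 O : fixD O -> O one.
Proof. by move=> [n [V [hV h]]]; apply: h => i _; rewrite act1; exact: nbhs_singleton. Qed.

(** The condition on [g] must depend on [h]: [g] moves [D i] slightly, and continuity of this one
    [act h] absorbs the move. *)
Lemma fixDM O : fixD O -> fixD [set h | fixD [set g | O (mul h g)]].
Proof.
move=> [n [V [hV VO]]].
exists n, (fun i => (V i)^°); split.
  by move=> i; apply: open_nbhs_nbhs; split; [exact: open_interior|exact: hV].
move=> h hh /=.
exists n, (fun i => if pselect (i < n)%N then act h @^-1` (V i) else setT); split.
  move=> i; case: pselect => [ni|nni]; last exact: filterT.
  exact: (@actC h (D i) (V i) (hh i ni)).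
by move=> g hg; apply: VO => i ni; have := hg i ni; case: pselect => // ?; rewrite actM.
Qed.

Lemma fixD_sub (F : set_system G) (phi : X -> X) : ProperFilter F ->
  (forall x, (fun g => act g x) @ F --> phi x) -> (forall i, phi (D i) = D i) ->
  fixD `<=` F.
Proof.
move=> PF hF phiD O [n [V [hV VO]]].
suff h : F [set g | forall i, (i < n)%N -> V i (act g (D i))] by apply: filterS h.
apply: filter_ltn => i _; apply: hF; rewrite phiD; exact: hV.
Qed.

Section FixedMean.
Context (M : X * (X -> R) -> R).
Hypothesis LM : local_mean act fixD M.
Hypothesis fixM : forall M', reach act fixD M M' -> M' = M.

Let stateM x : state (fun f => M (x, f)).
Proof. by have [[h _] _] := LM. Qed.

(** * Translations separated on average, by doubling of points *)

Section Splitting.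
Context (f : X -> R) (c : R) (U : set X).
Hypotheses (cf : continuous f) (c0 : 0 < c) (oU : open U).
Hypothesis denseM : forall V, open V -> V `<=` U -> V !=set0 ->
  exists2 x, V x & c <= M (x, fun y => `|f y - f x|).

Definition gap (g h : G) (x : X) := `|f (act g x) - f (act h x)|.

(** A new pair will have average gap above 3 c / 16. The threshold c / 8 lies below it, and the
    strict inequality leaves each pair a surplus to spend when points are later moved. *)
Definition split_inv (p : seq X * seq G) := [/\ p.1 != [::],
  forall x, x \in p.1 -> U x &
  forall i j, (i < j < size p.2)%N ->
    c / 8 * (size p.1)%:R < \sum_(x <- p.1) gap (nth one p.2 i) (nth one p.2 j) x].

(* Each point x of the list is doubled into nearby points d x in D and y x in the set of denseM;
   g almost fixes all the d x and moves the y x by c / 2 on average. *)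
Lemma split_step p : split_inv p ->
  exists q, split_inv q /\ exists g, q.2 = rcons p.2 g.
Proof.
case: p => r gs [/= r0 rU rgap].
have sr0 : (0 : R) < (size r)%:R by rewrite ltr0n lt0n size_eq0.
have [|s1 s10 hs1] := @common_lower_bound2 R (size gs) (fun i j =>
    (\sum_(x <- r) gap (nth one gs i) (nth one gs j) x - c / 8 * (size r)%:R) / (4 * (size r)%:R)).
  by move=> i j ij; rewrite divr_gt0 ?subr_gt0 ?rgap// mulr_gt0.
(* [c / 40] keeps the error [5 * s] of a new pair within c / 8; [s1] keeps the error [4 * s] of an
   old pair within half of its doubled surplus. *)
pose s := Num.min s1 (c / 40).
have s0 : 0 < s by rewrite lt_min s10 divr_gt0.
have sc : s <= c / 40 by rewrite ge_min lexx orbT.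
pose V x := [set y | U y /\ `|f y - f x| < s /\
  forall i, (i < size gs)%N -> `|f (act (nth one gs i) y) - f (act (nth one gs i) x)| < s].
have near_cts (u : X -> R) x : continuous u -> nbhs x [set y | `|u y - u x| < s].
  move=> cu; have /cvgrPdist_lt/(_ _ s0) := cu x.
  by apply: filterS => y /=; rewrite distrC.
have nV x : U x -> nbhs x (V x).
  move=> Ux; apply: filterI; first exact: open_nbhs_nbhs.
  apply: filterI; first exact: near_cts.
  by apply: filter_ltn => i _; apply: near_cts; apply: cts_comp.
have pts x : exists kd : nat * X, U x -> V x (D kd.1) /\ (V x kd.2 /\
    c <= M (kd.2, fun y => `|f y - f kd.2|)).
  have [Ux|] := pselect (U x); last by exists (0%N, x).
  have oV : open (V x)^° by exact: open_interior.
  have nVx : (V x)^° !=set0 by exists x; exact: nV.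
  have VU : (V x)^° `<=` U by move=> y /interior_subset[].
  have [k Dk] := Dense oV nVx; have [y Vy hy] := denseM oV VU nVx.
  exists (k, y) => _; split; first exact: interior_subset.
  by split => //; exact: interior_subset.
have [kd hkd] := choice pts.
pose d x := D (kd x).1; pose y x := (kd x).2.
have hd x : x \in r -> V x (d x) by move=> /rU/hkd[].
have hy x : x \in r -> V x (y x) by move=> /rU/hkd[_ []].
have hM x : x \in r -> c <= M (y x, fun z => `|f z - f (y x)|) by move=> /rU/hkd[_ []].
have FD := fixD_filter.
have NO : fixD [set g | forall x, x \in r -> `|f (act g (d x)) - f (d x)| < s].
  apply: filter_mem => x xr.
  by apply: (fixD_nbhs (V := [set z | `|f z - f (d x)| < s])); exact: near_cts.
have [g hgO hg] : exists2 g, forall x, x \in r -> `|f (act g (d x)) - f (d x)| < s &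
    c / 2 * (size r)%:R < \sum_(x <- r) `|f (act g (y x)) - f (y x)|.
  (* If all these [g] had a sum of at most [c / 2 * (size r)%:R], then so would [M], as a local
     mean; but its sum is at least [c * (size r)%:R]. *)
  apply: contrapT => hn.
  have cy x : continuous (fun z => `|f z - f (y x)|).
    by apply: ctsA; apply: ctsB => //; exact: ctsC.
  have := LM.2 _ NO [seq (y x, exist _ _ (cy x)) | x <- r] (c / 2 * (size r)%:R).
  rewrite !big_map/= => hle.
  have : \sum_(x <- r) M (y x, fun z => `|f z - f (y x)|) <= c / 2 * (size r)%:R.
    apply: hle => g hg; rewrite big_map/= leNgt; apply/negP => h'.
    by apply: hn; exists g.
  apply/negP; rewrite -ltNge.
  apply: (@lt_le_trans _ _ (c * (size r)%:R)).
    by rewrite ltr_pM2r// ltr_pdivrMr// ltr_pMr// ltr1n.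
  rewrite -sum_cst_seq big_seq [leRHS]big_seq.
  by apply: ler_sum => x; exact: hM.
exists ([seq d x | x <- r] ++ [seq y x | x <- r], rcons gs g); split; last by exists g.
split.
- by rewrite -size_eq0 size_cat !size_map addn_eq0 size_eq0 (negbTE r0).
- move=> x; rewrite mem_cat => /orP[] /mapP[z zr ->]; first by have [] := hd _ zr.
  by have [] := hy _ zr.
- move=> i j /=; rewrite size_rcons ltnS => /andP[ij].
  rewrite size_cat !size_map big_cat/= !big_map natrD -big_split/=.
  rewrite leq_eqVlt => /predU1P[jE|jlt].
    have ig : (i < size gs)%N by rewrite -jE.
    rewrite !nth_rcons ig jE ltnn eqxx.
    (* An older translation keeps [d x] and [y x] together while [g] pulls them apart. The loss is
       [2 * s] between the older images, [2 * s] between [f (d x)] and [f (y x)], and [s] for [g] at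
       [d x]. *)
    apply: (@lt_le_trans _ _ (\sum_(x <- r) (`|f (act g (y x)) - f (y x)| - 5 * s))).
      rewrite sumrB sum_cst_seq.
      apply: (@le_lt_trans _ _ (c / 2 * (size r)%:R - 5 * s * (size r)%:R)).
        have hs : s * (size r)%:R <= c / 40 * (size r)%:R by rewrite ler_wpM2r// ltW.
        have hc : 0 < c * (size r)%:R by rewrite mulr_gt0.
        nra.
      by rewrite ltrD2r.
    rewrite big_seq [leRHS]big_seq; apply: ler_sum => x xr.
    have [_ [d1 d2]] := hd _ xr; have [_ [y1 y2]] := hy _ xr.
    have := d2 _ ig; have := y2 _ ig; have := hgO _ xr; rewrite /gap.
    set h := nth _ _ _; move: d1 y1; clear.
    rewrite !ltr_norml.
    move=> /andP[? ?] /andP[? ?] /andP[? ?] /andP[? ?] /andP[? ?].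
    have h1 := ler_norm (f (act h (d x)) - f (act g (d x))).
    have h2 := ler_norm (f (act h (y x)) - f (act g (y x))).
    have h3 := ler_norm (- (f (act h (d x)) - f (act g (d x)))).
    have h4 := ler_norm (- (f (act h (y x)) - f (act g (y x)))).
    rewrite !normrN in h3 h4.
    have [h0|h0] := ler0P (f (act g (y x)) - f (y x)); lra.
  have ig : (i < size gs)%N by exact: ltn_trans jlt.
  rewrite !nth_rcons ig jlt.
  have h1 := hs1 i j; rewrite ij jlt in h1; have {}h1 := h1 isT.
  have ss1 : s <= s1 by rewrite ge_min lexx.
  apply: (@lt_le_trans _ _ (\sum_(x <- r) (2 * gap (nth one gs i) (nth one gs j) x - 4 * s))).
    rewrite sumrB sum_cst_seq -mulr_sumr.
    rewrite ler_pdivlMr in h1; last by rewrite mulr_gt0.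
    have h2 := rgap i j; rewrite ij jlt in h2; have {}h2 := h2 isT.
    set W := \sum_(x <- r) _ in h1 h2 *; nra.
  rewrite big_seq [leRHS]big_seq; apply: ler_sum => x xr.
  have [_ [_ d2]] := hd _ xr; have [_ [_ y2]] := hy _ xr.
  have := d2 _ ig; have := y2 _ ig; have := d2 _ jlt; have := y2 _ jlt; rewrite /gap.
  set h := nth _ _ i; set k := nth _ _ j; clear.
  rewrite !ltr_norml.
  move=> /andP[? ?] /andP[? ?] /andP[? ?] /andP[? ?].
  have h1 := ler_norm (f (act h (d x)) - f (act k (d x))).
  have h2 := ler_norm (f (act h (y x)) - f (act k (y x))).
  have h3 := ler_norm (- (f (act h (d x)) - f (act k (d x)))).
  have h4 := ler_norm (- (f (act h (y x)) - f (act k (y x)))).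
  rewrite !normrN in h3 h4.
  have [h0|h0] := ler0P (f (act h x) - f (act k x)); lra.
Qed.

Lemma no_splitting : ~ (U !=set0).
Proof.
move=> [x0 Ux0].
have inv0 : split_inv ([:: x0], [::]).
  by split => [//|x|i j]; [rewrite inE => /eqP->|rewrite ltn0 andbF].
have stepP (p : {p | split_inv p}) : exists q : {p | split_inv p},
    exists g, (sval q).2 = rcons (sval p).2 g.
  case: p => p ip; have [q [iq [g e]]] := split_step ip.
  by exists (exist _ q iq); exists g.
have [step hstep] := choice stepP.
pose P n := iter n step (exist _ _ inv0).
have sP n : size (sval (P n)).2 = n.
  elim: n => [//|n IH] /=; have [g ->] := hstep (P n).
  by rewrite size_rcons IH.
pose g n := nth one (sval (P n.+1)).2 n.
have gE n i : (i < n)%N -> nth one (sval (P n)).2 i = g i.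
  elim: n => [//|n IH]; rewrite ltnS leq_eqVlt => /predU1P[->//|ilt].
  rewrite -(IH ilt) /=; have [h ->] := hstep (P n).
  by rewrite nth_rcons sP ilt.
pose r n := (sval (P n)).1.
have r0 n : (0 : R) < (size (r n))%:R.
  by have [h _ _] := svalP (P n); rewrite ltr0n lt0n size_eq0.
pose Ls n := fun f : X -> R => \sum_(x <- r n) (size (r n))%:R^-1 * evaluation x f.
have sLs n : state (Ls n).
  apply: state_sum => [x|x|]; first exact: state_evaluation.
    by rewrite invr_ge0 ltW.
  by rewrite sum_cst_seq mulVf ?gt_eqF.
have [W [UW hW]] := @ultraFilterLemma _ (\oo : set_system nat) _.
have [L sL hL] := ultra_state cX UW sLs.
have c8 : 0 < c / 8 by rewrite divr_gt0.
apply: (not_separated hX cX act1 actM actC env_inj injE (g := g) sL cf c8) => i j ij.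
have cu : continuous (gap (g i) (g j)).
  by apply: ctsA; apply: ctsB; exact: cts_comp.
have PW : ProperFilter W by exact: ultra_proper.
have h1 : (fun _ : nat => c / 8) @ W --> c / 8 by exact: cvg_cst.
apply: (lim_le h1 (hL _ cu)); apply: hW; exists j.+1 => // n /= jn.
have [_ _ h] := svalP (P n).
have := h i j; rewrite sP ij jn => /(_ isT).
rewrite !gE//; last exact: ltn_trans jn.
rewrite -(ltr_pdivlMr _ _ (r0 n)) => /ltW/le_trans; apply.
by rewrite /Ls -mulr_sumr mulrC.
Qed.
End Splitting.

(** Pushing [M] along translations that converge to [phi] is a [reach], hence returns [M]; at [x] it
    carries the Dirac mass to the one at [phi x]. *)
Lemma mean_dirac_fixed x phi : (forall f, continuous f -> M (x, f) = f x) ->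
  env_elt act phi -> (forall i, phi (D i) = D i) -> phi x = x.
Proof.
move=> Mx [F PF hF] phiD.
have [W [UW FW]] := ultraFilterLemma PF.
have [T WT [phi' _ [hphi' Tphi]]] := ultra_pushes (R := R) cX actC UW.
have phiE : phi' = phi.
  apply/funext => z; apply: (@cvg_unique _ hX ((fun g => act g z) @ W)).
    exact: hphi'.
  by move=> V Vz; exact: (FW _ (hF z V Vz)).
have PW : ProperFilter W by exact: ultra_proper.
pose M' (p : X * (X -> R)) : R := if pselect (continuous p.2) then T (fun f => M (p.1, f)) p.2 else 0.
have M'E z f : continuous f -> M' (z, f) = T (fun f => M (z, f)) f.
  by move=> cf; rewrite /M'/=; case: pselect.
have RM' : reach act fixD M M'.
  split.
    split=> [z|z f ncf]; last by rewrite /M'; case: pselect.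
    have sT := pushes_state actC PW WT (stateM z).
    split.
    - by move=> f g cf cg; rewrite !M'E ?(stateD sT)//; exact: ctsD.
    - by move=> a f cf; rewrite !M'E ?(stateZ sT)//; exact: ctsZ.
    - by move=> f cf f0; rewrite M'E//; exact: (state_ge0 sT).
    - by rewrite M'E; [exact: (state_cst sT)|exact: ctsC].
  exists W => //; split.
    by apply: (fixD_sub (phi := phi)) => // z V Vz; exact: (FW _ (hF z V Vz)).
  by move=> z f cf; rewrite M'E//; exact: (WT _ _ (stateM z) cf).
have M'M := fixM RM'.
apply: fsep_inj => l.
rewrite -(Mx _ (@fsepC l)) -M'M M'E// -phiE -Tphi//.
apply: (lim_eq (WT _ _ (state_evaluation x) (@fsepC l)) (WT _ _ (stateM x) (@fsepC l))).
by apply: filterE => g /=; rewrite Mx//; exact: cts_comp.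
Qed.

(** One number bounds the points, the test functions and the tolerance, so that a countable family
    of conditions results. *)
Definition close_onD n g h := forall i l, (i < n)%N -> (l < n)%N ->
  `|fsep l (act g (D i)) - fsep l (act h (D i))| < n.+1%:R^-1.

(** Otherwise two sequences of translations have limits [phi] and [psi] that agree on [D] and differ
    at [x]. Composing [phi] with the inverse of [psi] gives an element that fixes [D] but not
    [x]. *)
Lemma dirac_controlled x l e : 0 < e -> (forall f, continuous f -> M (x, f) = f x) ->
  exists n, forall g h, close_onD n g h -> `|fsep l (act g x) - fsep l (act h x)| <= e.
Proof.
move=> e0 Mx; apply: contrapT => /forallNP hn.
have {}hn n : exists p : G * G, close_onD n p.1 p.2 /\
    e < `|fsep l (act p.1 x) - fsep l (act p.2 x)|.
  apply: contrapT => h; apply: (hn n) => g h' gh; rewrite leNgt; apply/negP => hlt.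
  by apply: h; exists (g, h').
have [p hp] := choice hn.
have [W [UW hW]] := @ultraFilterLemma _ (\oo : set_system nat) _.
have PW : ProperFilter W by exact: ultra_proper.
have lim (q : nat -> G) : exists2 phi, env_elt act phi &
    forall z, (fun n => act (q n) z) @ W --> phi z.
  have h z : exists w : X, (fun n => act (q n) z) @ W --> w.
    by have [|w _ hw] := @ultra_compact_cvg _ _ W (fun n => act (q n) z) _ UW cX;
      [exact: filterT|exists w].
  have [phi hphi] := choice h; exists phi => //.
  exists (q @ W); last exact: hphi.
  exact: fmap_proper_filter.
have [phi Ephi hphi] := lim (fun n => (p n).1).
have [psi Epsi hpsi] := lim (fun n => (p n).2).
have flim q theta : (forall z : X, (fun n : nat => act (q n) z) @ W --> (theta z : X)) ->
    forall k z, (fun n => fsep k (act (q n) z)) @ W --> fsep k (theta z).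
  by move=> h k z; apply: continuous_cvg; [exact: fsepC|exact: h].
have diff k z : (fun n => `|fsep k (act (p n).1 z) - fsep k (act (p n).2 z)|) @ W -->
    `|fsep k (phi z) - fsep k (psi z)|.
  by apply: cvg_norm; apply: cvgB; exact: flim.
have phipsiD i : phi (D i) = psi (D i).
  apply: fsep_inj => k; apply/eqP; rewrite -subr_eq0 -normr_le0.
  have h2 : (fun n : nat => n.+1%:R^-1 : R) @ W --> (0 : R).
    move=> V V0; apply: hW; exact: (@cvg_harmonic R V V0).
  apply: (lim_le (diff k (D i)) h2); apply: hW; exists (maxn i k).+1 => // n /= hn'.
  apply: ltW; apply: (hp n).1; apply: leq_trans hn'; rewrite ltnS ?leq_maxl ?leq_maxr//.
have phipsix : phi x <> psi x.
  move=> E; have : e <= `|fsep l (phi x) - fsep l (psi x)|.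
    have h2 : (fun _ : nat => e) @ W --> e by exact: cvg_cst.
    apply: (lim_le h2 (diff l x)); apply: filterE => n; apply: ltW.
    by have [] := hp n.
  by rewrite E subrr normr0 leNgt e0.
have [theta [Etheta thetapsi _]] := env_inverse hX cX act1 actM actC env_inj Epsi.
have : (theta \o phi) x = x.
  apply: mean_dirac_fixed => //; first exact: (env_comp actM).
  by move=> i /=; rewrite phipsiD; exact: (congr1 (@^~ (D i)) thetapsi).
rewrite -[RHS](congr1 (@^~ x) thetapsi)/= => /(env_inj Etheta).
exact: phipsix.
Qed.

End FixedMean.

(** Baire's theorem for sets that need not be closed, whence density in an open set rather than
    interior. *)
Lemma baire_cover (B : nat -> set X) : X ->
  (forall x, exists n, B n x) ->
  exists n U, [/\ open U, U !=set0 & forall V, open V -> V `<=` U -> V !=set0 ->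
    exists2 x, V x & B n x].
Proof.
move=> x0 cov; apply: contrapT => hn.
pose ok (W : set X) := open W /\ W !=set0.
have step n (W : set X) : exists W', ok W -> [/\ ok W', closure W' `<=` W &
    forall x, W' x -> ~ B n x].
  have [[oW nW]|] := pselect (ok W); last by exists W.
  have [V [oV VW nV VB]] : exists V, [/\ open V, V `<=` W, V !=set0 &
      forall x, V x -> ~ B n x].
    apply: contrapT => h; apply: hn; exists n, W; split => // V oV VW nV.
    apply: contrapT => h'; apply: h; exists V; split => // x Vx Bx.
    by apply: h'; exists x.
  have [y Vy] := nV.
  have [l [d d0 hd]] := fsepP (open_nbhs_nbhs (conj oV Vy)).
  have cl : continuous (fun z => `|fsep l z - fsep l y|).
    by apply: ctsA; apply: ctsB => //; exact: ctsC.
  (* Half the radius keeps the closure inside [V]. *)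
  exists ((fun z => `|fsep l z - fsep l y|) @^-1` [set t | t < d / 2]) => _.
  have dlt : d / 2 < d by rewrite ltr_pdivrMr// ltr_pMr// ltr1n.
  split.
  - split; last by exists y; rewrite /= subrr normr0 divr_gt0.
    by apply: open_comp; [move=> z _; exact: cl|exact: open_lt].
  - apply: (@subset_trans _ ((fun z => `|fsep l z - fsep l y|) @^-1` [set t | t <= d / 2])).
      have : closed ((fun z => `|fsep l z - fsep l y|) @^-1` [set t | t <= d / 2]).
        by apply: closed_comp; [move=> z _; exact: cl|exact: closed_le].
      rewrite closure_id => ->; apply: closure_subset => z /=; exact: ltW.
    by move=> z /= hz; apply: VW; apply: hd; exact: le_lt_trans dlt.
  - by move=> z /= hz; apply: VB; apply: hd; exact: lt_trans dlt.
have [st hst] := choice (fun p : nat * set X => step p.1 p.2).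
pose W := fix W n := if n is m.+1 then st (m, W m) else setT.
have okW n : ok (W n).
  elim: n => [|n IH]; first by split; [exact: openT|exists x0].
  by have [] := hst (n, W n) IH.
have dec n m : (n <= m)%N -> W m `<=` W n.
  move=> /subnK<-; elim: (m - n)%N => [//|k IH].
  have [_ h _] := hst (k + n, W (k + n))%N (okW (k + n)%N).
  by apply: subset_trans IH => z hz; apply: h; exact: subset_closure.
pose F := [set A | exists n, W n `<=` A].
have PF : ProperFilter F.
  apply: Build_ProperFilter_ex.
    by move=> A [n WA]; have [_ [z Wz]] := okW n; exists z; exact: WA.
  split.
  - by exists 0%N.
  - move=> A A' [n WA] [m WA']; exists (maxn n m) => z Wz; split.
      by apply: WA; apply: dec Wz; exact: leq_maxl.
    by apply: WA'; apply: dec Wz; exact: leq_maxr.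
  - by move=> A A' AA' [n WA]; exists n; exact: subset_trans AA'.
have [z [_ clz]] := cX PF (filterT).
have [n Bz] := cov z.
(* [z] is in the closure of [W n.+2], hence in [W n.+1], which was chosen to avoid [B n]. *)
have [_ _ h] := hst (n, W n) (okW n); apply: (h z) => //.
have [_ h' _] := hst (n.+1, W n.+1) (okW n.+1); apply: h'.
by move=> V Vz; apply: clz => //; exists n.+2.
Qed.

(* By compactness, some g0 is close on D to all g of a large set: there fsep l o g differs from fsep l o g0 by e. *)
Lemma equicontinuous_of_close j l e (U : set X) y0 : 0 < e -> open U -> U y0 ->
  (forall g h z, U z -> close_onD j g h -> `|fsep l (act g z) - fsep l (act h z)| <= e) ->
  nbhs y0 [set y | forall g, `|fsep l (act g y) - fsep l (act g y0)| <= e + e + e].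
Proof.
move=> e0 oU Uy0 TU; apply: near_forall_ultra => W UW Wy0 Wbad.
have PW : ProperFilter W by exact: ultra_proper.
have h i k : exists a : R, (fun p : G * X => fsep k (act p.1 (D i))) @ W --> a.
  have [b b0 fb] := cts_bounded cX (@fsepC k).
  have [|a _ ha] := @ultra_compact_cvg _ _ W (fun p : G * X => fsep k (act p.1 (D i)))
     `[-b, b] UW (@segment_compact _ _ _); last by exists a.
  by apply: filterE => p /=; rewrite in_itv/= -ler_norml.
have [a ha] := choice (fun ik : nat * nat => h ik.1 ik.2).
(* Half the tolerance, since two translations are compared through the common limit [a]. *)
have j0 : (0 : R) < j.+1%:R^-1 / 2 by rewrite divr_gt0// invr_gt0.
pose Q := [set p : G * X | forall i, (i < j)%N -> forall k, (k < j)%N ->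
  `|a (i, k) - fsep k (act p.1 (D i))| < j.+1%:R^-1 / 2].
have WQ : W Q.
  apply: filter_ltn => i _; apply: filter_ltn => k _.
  by have /cvgrPdist_lt/(_ _ j0) := ha (i, k).
have close p q : Q p -> Q q -> close_onD j p.1 q.1.
  move=> Qp Qq i k ij kj; have := Qp i ij k kj; have := Qq i ij k kj.
  rewrite !ltr_norml => /andP[h1 h2] /andP[h3 h4].
  set t := j.+1%:R^-1 in h1 h2 h3 h4 *.
  by apply/andP; split; lra.
have [p0 Qp0] := filter_ex WQ.
have c0 : continuous (fun y => fsep l (act p0.1 y)) by exact: cts_comp.
pose V := U `&` [set y | `|fsep l (act p0.1 y0) - fsep l (act p0.1 y)| < e].
have nb : nbhs y0 V.
  apply: filterI; first exact: open_nbhs_nbhs.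
  by have /cvgrPdist_lt/(_ _ e0) := c0 y0.
have [p [[Qp [Up hp]] /= bp]] := filter_ex (filterI (filterI WQ (Wy0 _ nb)) Wbad).
have h1 := TU _ _ _ Up (close _ _ Qp Qp0).
have h2 := TU _ _ _ Uy0 (close _ _ Qp Qp0).
apply: bp; rewrite (_ : _ - _ = (fsep l (act p.1 p.2) - fsep l (act p0.1 p.2)) +
  (fsep l (act p0.1 p.2) - fsep l (act p0.1 y0)) +
  (fsep l (act p0.1 y0) - fsep l (act p.1 y0))); last by ring.
apply: le_trans (ler_normD _ _) _.
rewrite lerD//; last by rewrite distrC.
apply: le_trans (ler_normD _ _) _; rewrite lerD//.
by rewrite distrC ltW.
Qed.

Hypothesis minX : forall x : X, closure (range (fun g => act g x)) = setT.

Lemma equicontinuous_fsep l e (x : X) : 0 < e ->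
  nbhs x [set y | forall g, `|fsep l (act g y) - fsep l (act g x)| <= e].
Proof.
move=> e0.
have [M LM fixM] := fixed_mean hX cX act1 actM actC env_inj injE fixD1 fixDM.
have e30 : 0 < e / 3 by rewrite divr_gt0.
pose A (k m : nat) := [set z | m.+1%:R^-1 <= M (z, fun y => `|fsep k y - fsep k z|)].
pose T n := [set z | forall g h, close_onD n g h ->
  `|fsep l (act g z) - fsep l (act h z)| <= e / 3].
(* A single countable family: the [A k m] cover the points where [M] is not Dirac, by [state_dirac],
   and the [T n] cover the others, by [dirac_controlled]. *)
pose C (b : option (nat * nat) * nat) := if b.1 is Some (k, m) then A k m else T b.2.
have [|n [U [oU nU denseU]]] :=
  @baire_cover (fun n => if unpickle n is Some b then C b else set0) x.
  move=> z; have [[k [m Akm]]|hA] := pselect (exists k m, A k m z).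
    by exists (pickle (Some (k, m), 0%N)); rewrite pickleK.
  have Mz : forall f, continuous f -> M (z, f) = f z.
    apply: (state_dirac (L := fun f => M (z, f))) => [|k]; first exact: LM.1.1.
    rewrite leNgt; apply/negP => h; apply: hA; exists k.
    have [m] := ltr_add_invr h; rewrite add0r => hm.
    by exists m; exact: ltW.
  have [m hm] := dirac_controlled LM fixM l e30 Mz.
  by exists (pickle (@None (nat * nat), m)); rewrite pickleK.
case: (unpickle n) denseU => [[[[k m]|] j]|] denseU; last first.
- by have [//|z _ []] := denseU U oU _ nU.
(* For fixed [g] and [h] the bound is a closed condition on the point, so it passes from a dense
   subset to all of [U]. *)
- have TU g h z : U z -> close_onD j g h -> `|fsep l (act g z) - fsep l (act h z)| <= e / 3.
    move=> Uz gh; rewrite leNgt; apply/negP => hlt.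
    have cu : continuous (fun z => `|fsep l (act g z) - fsep l (act h z)|).
      by apply: ctsA; apply: ctsB; apply: cts_comp.
    pose V := U `&` (fun z => `|fsep l (act g z) - fsep l (act h z)|) @^-1` [set t | e / 3 < t].
    have [|||w [_ /= hw] Tw] := denseU V.
    + by apply: openI => //; apply: open_comp; [move=> ? _; exact: cu|exact: open_gt].
    + by move=> ? [].
    + by exists z.
    by have := Tw _ _ gh; rewrite leNgt hw.
  have [y0 Uy0] := nU.
  have nU0 : nbhs y0 U by exact: open_nbhs_nbhs.
  have : closure (range (fun g => act g x)) y0 by rewrite minX.
  (* Minimality brings [x] into [U] by some [h]; equicontinuity at [act h x] returns to [x] by
     writing [g] as [mul (mul g (inv h)) h]. *)
  move=> /(_ U nU0)[_ [[h _ <-] Uhx]].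
  have key := equicontinuous_of_close e30 oU Uhx TU.
  have nkey := @actC h x _ key; apply: (@filterS _ (nbhs x) _ _ _ _ nkey) => y /= hy g.
  have := hy (mul g (inv h)); rewrite !actM !actV.
  by rewrite (_ : e / 3 + e / 3 + e / 3 = e)//; field.
- have mp : (0 : R) < m.+1%:R^-1 by rewrite invr_gt0.
  by case: (no_splitting LM (@fsepC k) mp oU denseU nU).
Qed.
End Dynamics.

(** * The Riesz representation theorem *)

Section Separation.
Context {R : realType} {X : topologicalType}.
Hypothesis nX : normal_space X.

Lemma urysohn_bump (A U : set X) : closed A -> open U -> A `<=` U ->
  exists g : X -> R, [/\ continuous g, forall x, 0 <= g x <= 1,
    forall x, A x -> g x = 1 & forall x, ~ U x -> g x = 0].
Proof.
move=> cA oU AU.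
have sep : uniform_separator (~` U) A.
  apply: (normal_separatorP (R := R)).1 => //; first exact: open_closedC.
  by apply/seteqP; split => // x [nU /AU].
exists (Urysohn (R := R) (~` U) A); split.
- exact: Urysohn_continuous.
- move=> x; have /(_ _ (imageP _ I)) := @Urysohn_range X R (~` U) A.
  by move=> /(_ x); rewrite /= in_itv.
- by move=> x Ax; apply: (Urysohn_sub1 sep); exists x.
- by move=> x nUx; apply: (Urysohn_sub0 sep); exists x.
Qed.

Lemma ctsMax (f g : X -> R) : continuous f -> continuous g ->
  continuous (fun x => Num.max (f x) (g x)).
Proof. by move=> cf cg x; exact: (continuous_max (cf x) (cg x)). Qed.

Lemma ctsMin (f g : X -> R) : continuous f -> continuous g ->
  continuous (fun x => Num.min (f x) (g x)).
Proof. by move=> cf cg x; exact: (continuous_min (cf x) (cg x)). Qed.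
End Separation.

Section RieszContent.
Context {R : realType} {X : topologicalType}.
Implicit Types (f g : X -> R) (U V : set X).
Hypothesis nX : normal_space X.
Hypothesis cX : compact [set: X].
Context (L : (X -> R) -> R).
Hypothesis sL : state L.

Definition bump U f := [/\ continuous f, forall x, 0 <= f x <= 1 &
  forall x, ~ U x -> f x = 0].

Definition content U := sup [set L f | f in bump U].

Lemma bump0 U : bump U (fun=> 0).
Proof. by split => // [|x]; [exact: ctsC|rewrite lexx ler01]. Qed.

Lemma content_has_sup U : has_sup [set L f | f in bump U].
Proof.
split; first by exists (L (fun=> 0)); exists (fun=> 0) => //; exact: bump0.
exists 1 => _ [f [cf f01 _] <-]; apply: (state_le_cst sL) => // x.
by have /andP[] := f01 x.
Qed.

Lemma content_ge U f : bump U f -> L f <= content U.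
Proof. by move=> Uf; apply: ub_le_sup; [case: (content_has_sup U)|exists f]. Qed.

Lemma content_le U a : (forall f, bump U f -> L f <= a) -> content U <= a.
Proof.
by move=> h; apply: ge_sup; [case: (content_has_sup U)|move=> _ [f Uf <-]; exact: h].
Qed.

Lemma content_ge0 U : 0 <= content U.
Proof. by rewrite -(state_cst sL 0); apply: content_ge; exact: bump0. Qed.

Lemma content_le1 U : content U <= 1.
Proof.
apply: content_le => f [cf f01 _]; apply: (state_le_cst sL) => // x.
by have /andP[] := f01 x.
Qed.

Lemma le_content U V : U `<=` V -> content U <= content V.
Proof.
move=> UV; apply: content_le => f [cf f01 f0]; apply: content_ge; split => // x nV.
by apply: f0 => /UV.
Qed.

Lemma content_set0 : content set0 = 0.
Proof.
apply/eqP; rewrite eq_le content_ge0 andbT; apply: content_le => f [cf _ f0].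
by rewrite -(state_cst sL 0); apply: state_le => //; [exact: ctsC|move=> x; rewrite f0].
Qed.

Lemma content_setT : content setT = 1.
Proof.
apply/eqP; rewrite eq_le content_le1/= -(state_cst sL 1); apply: content_ge.
by split => // [|x|x /(_ I)//]; [exact: ctsC|rewrite lexx ler01].
Qed.

(** It can be nonzero only in the closed set where [e <= f]. This replaces the compact supports of
    the usual construction, at a cost of at most [e] under [L]. *)
Definition trim e f := fun x => Num.max (f x - e) 0.

Lemma trim_cts e f : continuous f -> continuous (trim e f).
Proof. by move=> cf; apply: ctsMax; [apply: ctsB => //|]; exact: ctsC. Qed.

Lemma trim_ge e f : continuous f -> L f <= L (trim e f) + e.
Proof.
move=> cf; have ct := trim_cts (e := e) cf.
rewrite -[X in _ <= _ + X](state_cst sL e) -(stateD sL)//; last exact: ctsC.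
apply: state_le => //; first by apply: ctsD => //; exact: ctsC.
by move=> x; rewrite /trim -lerBlDr le_max lexx.
Qed.

Lemma trim01 e f x : 0 <= e -> 0 <= f x <= 1 -> 0 <= trim e f x <= 1.
Proof. by move=> e0 /andP[f0 f1]; rewrite /trim le_max lexx orbT ge_max; lra. Qed.

Lemma trim0 e f x : f x <= e -> trim e f x = 0.
Proof. by move=> fe; rewrite /trim max_r// subr_le0. Qed.

Lemma closed_superlevel f e : continuous f -> closed [set x | e <= f x].
Proof.
move=> cf; rewrite -[X in closed X]/(f @^-1` [set t | e <= t]).
by apply: closed_comp; [move=> x _; exact: cf|exact: closed_ge].
Qed.

(** A Urysohn function [g], equal to 1 on the part of the superlevel set outside [V] and to 0
    outside [U], splits [trim e f] into admissible pieces for [U] and [V]. *)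
Lemma content_setU U V : open U -> open V -> content (U `|` V) <= content U + content V.
Proof.
move=> oU oV; apply: content_le => f [cf f01 f0].
apply/ler_addgt0Pr => e e0; apply: le_trans (trim_ge e cf) _; rewrite lerD2r.
have ct := trim_cts (e := e) cf.
have [|||g [cg g01 g1 g0]] := @urysohn_bump R X nX ([set x | e <= f x] `&` ~` V) U.
- by apply: closedI; [exact: closed_superlevel|exact: open_closedC].
- by [].
- move=> x [/= ef nV]; apply: contrapT => nU.
  by move: ef; rewrite f0 ?leNgt ?e0// => -[].
have cu := ctsM ct cg.
have cv : continuous (fun x => trim e f x * (1 - g x)).
  by apply: ctsM => //; apply: ctsB => //; exact: ctsC.
rewrite (_ : trim e f = fun x => trim e f x * g x + trim e f x * (1 - g x)); last first.
  by apply/funext => x; ring.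
rewrite stateD//; apply: lerD; apply: content_ge; split => // x.
- have /andP[t0 t1] := trim01 (ltW e0) (f01 x); have /andP[h0 h1] := g01 x.
  by rewrite mulr_ge0//= mulr_ile1.
- by move=> nU; rewrite g0// mulr0.
- have /andP[t0 t1] := trim01 (ltW e0) (f01 x); have /andP[h0 h1] := g01 x.
  by rewrite mulr_ge0 ?subr_ge0//= mulr_ile1 ?subr_ge0// gerBl.
- move=> nV; have [ef|/ltW fe] := leP e (f x); last by rewrite trim0 ?mul0r.
  by rewrite g1// subrr mulr0.
Qed.

Lemma content_bigsetU (U : nat -> set X) n : (forall i, open (U i)) ->
  content (\bigcup_(i < n) U i) <= \sum_(i < n) content (U i).
Proof.
move=> oU; elim: n => [|n IH]; first by rewrite bigcup_mkord !big_ord0 content_set0.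
rewrite bigcup_mkord !big_ord_recr/= -bigcup_mkord.
apply: le_trans (content_setU _ _) _ => //; first by apply: bigcup_open => i _.
by rewrite lerD2r.
Qed.

(** By compactness finitely many [U i] cover a superlevel set of a nearly optimal [f]; one half of
    [e] pays for the choice of [f], the other for trimming. *)
Lemma content_bigcup (U : nat -> set X) e : (forall i, open (U i)) -> 0 < e ->
  exists n, content (\bigcup_i U i) <= \sum_(i < n) content (U i) + e.
Proof.
move=> oU e0.
have e2 : 0 < e / 2 by rewrite divr_gt0.
have [f [cf f01 f0] hf] : exists2 f, bump (\bigcup_i U i) f & content (\bigcup_i U i) - e / 2 < L f.
  by have [_ [f Uf <-] h] := sup_adherent e2 (content_has_sup (\bigcup_i U i)); exists f.
suff [n hn] : exists n, [set x | e / 2 <= f x] `<=` \bigcup_(i < n) U i.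
  exists n; apply: le_trans (_ : _ <= content (\bigcup_(i < n) U i) + e) _; last first.
    by rewrite lerD2r; exact: content_bigsetU.
  have h1 := trim_ge (e / 2) cf.
  have : L (trim (e / 2) f) <= content (\bigcup_(i < n) U i).
    apply: content_ge; split; first exact: trim_cts.
      by move=> x; apply: trim01 => //; exact: ltW.
    by move=> x nx; rewrite trim0// leNgt; apply/negP => /ltW/hn.
  by lra.
apply: contrapT => /forallNP hn.
pose F := [set A | exists n, [set x | e / 2 <= f x] `\` \bigcup_(i < n) U i `<=` A].
have PF : ProperFilter F.
  apply: Build_ProperFilter_ex.
    move=> A [n hA]; apply: contrapT => h; apply: (hn n) => x fx.
    by apply: contrapT => nx; apply: h; exists x; exact: hA.
  split.
  - by exists 0%N.
  - move=> A B [n hA] [m hB]; exists (maxn n m) => x [fx nx]; split.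
      apply: hA; split => // -[i /= ni Ui]; apply: nx; exists i => //=.
      by rewrite leq_max ni.
    apply: hB; split => // -[i /= ni Ui]; apply: nx; exists i => //=.
    by rewrite leq_max ni orbT.
  - by move=> A B AB [n hA]; exists n; exact: subset_trans AB.
have [x [_ clx]] := cX PF (filterT).
have fx : e / 2 <= f x.
  apply: (closed_superlevel (e := e / 2) cf) => V Vx.
  by apply: clx => //; exists 0%N => y [].
have [i _ Uix] : (\bigcup_i U i) x.
  by apply: contrapT => nx; move: fx; rewrite f0// leNgt e2.
have FD : F ([set x | e / 2 <= f x] `\` \bigcup_(j < i.+1) U j) by exists i.+1.
have [y [[_ ny] Uy]] := clx _ _ FD (open_nbhs_nbhs (conj (oU i) Uix)).
by apply: ny; exists i => /=.
Qed.

End RieszContent.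

(** * The outer measure and the measurability of open sets *)

Section RieszMeasure.
Context {R : realType} {X : ptopologicalType}.
Implicit Types (f g : X -> R) (U V A B : set X).
Hypothesis nX : normal_space X.
Hypothesis cX : compact [set: X].
Context (L : (X -> R) -> R).
Hypothesis sL : state L.

Definition outer_content A := inf [set content L U | U in [set U | open U /\ A `<=` U]].

Lemma outer_has_inf A : has_inf [set content L U | U in [set U | open U /\ A `<=` U]].
Proof.
split; first by exists (content L setT); exists setT => //; split => //; exact: openT.
by exists 0 => _ [U _ <-]; exact: content_ge0.
Qed.

Lemma outer_le A U : open U -> A `<=` U -> outer_content A <= content L U.
Proof. by move=> oU AU; apply: ge_inf; [case: (outer_has_inf A)|exists U]. Qed.

Lemma outer_ge A a : (forall U, open U -> A `<=` U -> a <= content L U) -> a <= outer_content A.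
Proof.
move=> h; apply: lb_le_inf; first by case: (outer_has_inf A).
by move=> _ [U [oU AU] <-]; exact: h.
Qed.

Lemma outer_open U : open U -> outer_content U = content L U.
Proof.
move=> oU; apply/eqP; rewrite eq_le outer_le//=; apply: outer_ge => V oV UV.
exact: le_content.
Qed.

Lemma outer_ge0 A : 0 <= outer_content A.
Proof. by apply: outer_ge => U _ _; exact: content_ge0. Qed.

Lemma le_outer : {homo (fun A => (outer_content A)%:E) : A B / A `<=` B >-> (A <= B)%E}.
Proof.
move=> A B AB; rewrite lee_fin; apply: outer_ge => U oU BU; apply: outer_le => //.
exact: subset_trans BU.
Qed.

Lemma outer_sigma_subadditive : sigma_subadditive (fun A => (outer_content A)%:E).
Proof.
move=> F; apply/lee_addgt0Pr => e e0.
have e2 : 0 < e / 2 by rewrite divr_gt0.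
have h i : exists U, [/\ open U, F i `<=` U &
    content L U <= outer_content (F i) + e / 2 / (2 ^ i.+1)%:R].
  have ei : 0 < e / 2 / (2 ^ i.+1)%:R by rewrite divr_gt0// ltr0n expn_gt0.
  have [_ [U [oU FU] <-] hU] := inf_adherent ei (outer_has_inf (F i)).
  by exists U; split => //; exact: ltW.
have [U hU] := choice h.
have oU i : open (U i) by have [] := hU i.
have [n hn] := content_bigcup nX cX sL oU e2.
have h1 : outer_content (\bigcup_n F n) <= \sum_(i < n) content L (U i) + e / 2.
  apply: le_trans hn; apply: outer_le; first by apply: bigcup_open => i _.
  by move=> x [i _ Fx]; exists i => //; have [_ + _] := hU i; exact.
apply: (@le_trans _ _ (\sum_(i < n) (content L (U i))%:E + (e / 2)%:E)%E).
  by rewrite sumEFin -EFinD lee_fin.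
rewrite [in leRHS](splitr e) EFinD addeA leeD2r//.
apply: le_trans (epsilon_trick xpredT (A := fun i => (outer_content (F i))%:E) _ (ltW e2)).
  apply: (@le_trans _ _ (\sum_(0 <= i < n) ((outer_content (F i))%:E + (e / 2 / (2 ^ i.+1)%:R)%:E))%E).
    rewrite big_mkord; apply: lee_sum => i _.
    by rewrite -EFinD lee_fin; have [] := hU i.
  apply: nneseries_lim_ge => i _ _; apply: adde_ge0; rewrite lee_fin ?outer_ge0//.
  by rewrite divr_ge0// ltW.
by move=> i; rewrite lee_fin outer_ge0.
Qed.

Lemma outer_set0 : (outer_content set0)%:E = 0%E.
Proof. by rewrite outer_open ?content_set0//; exact: open0. Qed.

Definition riesz_outer : {outer_measure set X -> \bar R} := HB.pack (fun A => (outer_content A)%:E)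
  (isOuterMeasure.Build R X (fun A => (outer_content A)%:E) outer_set0
    (fun A => outer_ge0 A) le_outer outer_sigma_subadditive).

(** For [f] admissible in [V] cut with [U], the set where [f < e] inside [V] contains the part of
    [A] outside [U]. If [g] is admissible there, [trim e f] and [g] are nowhere both nonzero, so
    their sum is admissible for [V]. *)
Lemma open_caratheodory U : open U -> riesz_outer.-caratheodory U.
Proof.
move=> oU; apply: le_caratheodory_measurable => A /=.
rewrite -EFinD lee_fin; apply: outer_ge => V oV AV.
have h1 : outer_content (A `&` U) <= content L (V `&` U).
  by apply: outer_le; [exact: openI|exact: setSI].
suff : content L (V `&` U) <= content L V - outer_content (A `&` ~` U) by lra.
apply: content_le => // f [cf f01 f0].
apply/ler_addgt0Pr => e e0; have h2 := trim_ge sL e cf.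
pose W := V `&` ~` [set x | e <= f x].
have oW : open W.
  by apply: openI => //; apply: closed_openC; exact: closed_superlevel.
have h3 : outer_content (A `&` ~` U) <= content L W.
  apply: outer_le => // x [Ax nUx]; split; first exact: AV.
  move=> /= ef; apply: nUx; apply: contrapT => nU.
  by move: ef; rewrite f0 ?leNgt ?e0// => -[].
suff : content L W <= content L V - L (trim e f) by lra.
apply: content_le => // g [cg g01 g0].
rewrite lerBrDr addrC -(stateD sL)//; last exact: trim_cts.
apply: content_ge => //; split.
- by apply: ctsD => //; exact: trim_cts.
- move=> x; have /andP[t0 t1] := trim01 (ltW e0) (f01 x); have /andP[h0 h1'] := g01 x.
  have [ef|/ltW fe] := leP e (f x); last by rewrite trim0// add0r h0.
  by rewrite g0 ?addr0 ?t0// => -[_]; exact.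
- move=> x nV; have fx : f x = 0 by apply: f0 => -[].
  by rewrite trim0 ?fx ?(ltW e0)// add0r g0// => -[].
Qed.

Lemma borel_caratheodory (A : set (borel_type X)) : measurable A ->
  (measurable : set (set (caratheodory_type riesz_outer))) A.
Proof.
apply: smallest_sub; first exact: (sigma_algebra_measurable (caratheodory_type riesz_outer)).
by move=> U oU; exact: open_caratheodory.
Qed.

Definition riesz_fun (A : set (borel_type X)) := riesz_outer A.

Lemma riesz_fun0 : riesz_fun set0 = 0%E. Proof. exact: outer_set0. Qed.

Lemma riesz_fun_ge0 A : (0 <= riesz_fun A)%E. Proof. exact: (outer_ge0 A). Qed.

Lemma riesz_sigma_additive : semi_sigma_additive riesz_fun.
Proof.
move=> F mF tF mUF.
apply: (@caratheodory_measure_sigma_additive R X riesz_outer F) => //.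
  by move=> i; exact: borel_caratheodory.
exact: borel_caratheodory.
Qed.

Lemma riesz_setT : riesz_fun setT = 1%E.
Proof.
by rewrite /riesz_fun /riesz_outer/= outer_open ?content_setT//; exact: openT.
Qed.

HB.instance Definition _ := isMeasure.Build _ (borel_type X) R riesz_fun
  riesz_fun0 riesz_fun_ge0 riesz_sigma_additive.

HB.instance Definition _ := Measure_isProbability.Build _ (borel_type X) R riesz_fun riesz_setT.

Definition riesz_measure : probability (borel_type X) R := riesz_fun.

Lemma riesz_measure_open U : open U -> riesz_measure U = (content L U)%:E.
Proof. by move=> oU; rewrite /= /riesz_fun /riesz_outer/= outer_open. Qed.

End RieszMeasure.

Section BorelIntegral.
Context {R : realType} {X : ptopologicalType}.
Implicit Types (f g : X -> R) (mu : probability (borel_type X) R).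
Hypothesis cX : compact [set: X].

Lemma open_borel (U : set X) : open U -> measurable (U : set (borel_type X)).
Proof. by move=> oU; exact: sub_sigma_algebra. Qed.

Lemma cts_measurable f : continuous f -> measurable_fun setT (f : borel_type X -> R).
Proof.
move=> cf; apply: (measurability _ (RGenOpens.measurableE R)).
move=> _ [_ [a [b ->] <-]]; rewrite setTI; apply: open_borel.
by apply: open_comp; [move=> x _; exact: cf|exact: interval_open].
Qed.

Lemma cts_integrable mu f : continuous f -> mu.-integrable setT (EFin \o (f : borel_type X -> R)).
Proof.
move=> cf; apply: measurable_bounded_integrable => //.
- exact: le_lt_trans (probability_le1 mu measurableT) (ltry 1).
- exact: cts_measurable.
- have [B B0 fB] := cts_bounded cX cf.
  exists B; split; first exact: num_real.
  by move=> M BM x _ /=; apply: le_trans (fB x) (ltW BM).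
Qed.

Definition integral_state mu : (X -> R) -> R :=
  fun f => fine (\int[mu]_x (f x)%:E).

Lemma integral_stateE mu f : continuous f ->
  (\int[mu]_x (f x)%:E)%E = (integral_state mu f)%:E.
Proof. by move=> cf; rewrite fineK//; exact: (integrable_fin_num _ (cts_integrable mu cf)). Qed.

Lemma integral_state_state mu : state (integral_state mu).
Proof.
split.
- move=> f g cf cg; apply: EFin_inj; rewrite EFinD -!integral_stateE//; last exact: ctsD.
  by rewrite -integralD//; exact: cts_integrable.
- move=> a f cf; apply: EFin_inj; rewrite EFinM -!integral_stateE//; last exact: ctsZ.
  by rewrite -integralZl//; exact: cts_integrable.
- move=> f cf f0; rewrite -lee_fin -integral_stateE//.
  by apply: integral_ge0 => x _; rewrite lee_fin.
- apply: EFin_inj; rewrite -integral_stateE; last exact: ctsC.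
  transitivity (1 * mu setT)%E; first exact: (@integral_cst _ (borel_type X) R mu setT measurableT 1%E).
  by rewrite mul1e; exact: (probability_setT mu).
Qed.

Lemma integral_state_dirac x f : continuous f ->
  integral_state (@dirac _ (borel_type X) x R) f = f x.
Proof.
move=> cf; apply: EFin_inj; rewrite -integral_stateE//.
rewrite integral_dirac//; last by apply/measurable_EFinP; exact: cts_measurable.
by rewrite diracT mul1e.
Qed.
End BorelIntegral.

(** * Integrals against the Riesz measure, and uniqueness *)

Section RieszRepresentation.
Context {R : realType} {X : ptopologicalType}.
Implicit Types (f g : X -> R) (mu nu : probability (borel_type X) R).
Hypothesis nX : normal_space X.
Hypothesis cX : compact [set: X].

Lemma cts_markov mu g (U : set X) a : measurable (U : set (borel_type X)) ->
  continuous g -> 0 <= a -> (forall x, 0 <= g x) -> (forall x, U x -> a <= g x) ->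
  (a%:E * mu U <= (integral_state mu g)%:E)%E.
Proof.
move=> mU cg a0 g0 ag; rewrite -(integral_stateE cX)//.
have mg : measurable_fun [set: borel_type X] (EFin \o (g : borel_type X -> R)).
  by apply/measurable_EFinP; exact: cts_measurable.
apply: (@le_trans _ _ (\int[mu]_(x in U) (g x)%:E)%E).
  rewrite -(@integral_cst _ (borel_type X) R mu U mU a%:E).
  by apply: ge0_le_integral => //; exact: measurable_funS mg.
apply: (@ge0_subset_integral _ (borel_type X) R mu U setT mU measurableT (EFin \o g) mg) => //.
by move=> x _; rewrite lee_fin.
Qed.

Lemma cts_sum (u : nat -> X -> R) m : (forall i, continuous (u i)) ->
  continuous (fun x => \sum_(i < m) u i x).
Proof.
move=> cu; elim: m => [|m IH].
  rewrite (_ : (fun x => _) = fun=> 0); first exact: ctsC.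
  by apply/funext => x; rewrite big_ord0.
rewrite (_ : (fun x => _) = fun x => \sum_(i < m) u i x + u m x); first exact: ctsD.
by apply/funext => x; rewrite big_ord_recr.
Qed.

Lemma state_bigsum (L : (X -> R) -> R) (u : nat -> X -> R) m : state L ->
  (forall i, continuous (u i)) ->
  L (fun x => \sum_(i < m) u i x) = \sum_(i < m) L (u i).
Proof.
move=> sL cu; elim: m => [|m IH].
  rewrite big_ord0 -[RHS](state_cst sL 0); congr L.
  by apply/funext => x; rewrite big_ord0.
rewrite big_ord_recr/= -IH -(stateD sL)//; last exact: cts_sum.
by congr L; apply/funext => x; rewrite big_ord_recr.
Qed.

Definition slice (h : R) (i : nat) (t : R) := Num.min (Num.max (t - i%:R * h) 0) h.

Lemma sum_slice h m t : 0 <= h -> 0 <= t -> \sum_(i < m) slice h i t = Num.min t (m%:R * h).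
Proof.
move=> h0 t0; elim: m => [|m IH]; first by rewrite big_ord0 mul0r min_r.
have m0 : 0 <= m%:R * h by rewrite mulr_ge0.
rewrite big_ord_recr/= IH /slice -natr1 mulrDl mul1r.
set a := m%:R * h in m0 *.
by rewrite /Num.min /Num.max; repeat case: ifPn; rewrite -?leNgt; lra.
Qed.

(* f is cut into horizontal slices of height h; the i-th slice is at most h times the indicator of {f > ih},
   which is at most the (i-1)-st slice. *)
Lemma riesz_le (L : (X -> R) -> R) (sL : state L) f : continuous f -> (forall x, 0 <= f x <= 1) ->
  L f <= integral_state (riesz_measure nX cX sL) f.
Proof.
move=> cf f01; set mu := riesz_measure _ _ _.
have smu := integral_state_state cX mu.
apply/ler_addgt0Pr => e e0.
have [N hN] := ltr_add_invr e0; rewrite add0r in hN.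
pose h : R := N.+1%:R^-1.
have h0 : 0 < h by rewrite invr_gt0.
have Nh : N.+1%:R * h = 1 by rewrite mulfV.
pose u i x := slice h i (f x).
have cu i : continuous (u i).
  by apply: ctsMin; [apply: ctsMax; [apply: ctsB => //|]|]; exact: ctsC.
have u0 i x : 0 <= u i x by rewrite /u /slice le_min (ltW h0) le_max lexx orbT.
have fE : f = fun x => \sum_(i < N.+1) u i x.
  apply/funext => x; have /andP[x0 x1] := f01 x.
  by rewrite sum_slice ?(ltW h0)// Nh min_l.
have Lu i : L (u i) <= h * content L [set x | i%:R * h < f x].
  rewrite -ler_pdivrMl// -stateZ//; apply: content_ge => //; split; first exact: ctsZ.
    move=> x; rewrite mulr_ge0 ?invr_ge0 ?(ltW h0)//= ler_pdivrMl// mulr1.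
    by rewrite /u /slice ge_min lexx orbT.
  move=> x /negP; rewrite -leNgt => fx; rewrite /u /slice max_r ?subr_le0//.
  by rewrite min_l ?mulr0// ltW.
have oU i : open [set x | i%:R * h < f x].
  by apply: (@open_comp _ _ f [set t | i%:R * h < t]); [move=> x _; exact: cf|exact: open_gt].
have uI i : h * content L [set x | i.+1%:R * h < f x] <= integral_state mu (u i).
  rewrite -lee_fin EFinM -(riesz_measure_open nX cX sL)//.
  apply: cts_markov; [exact: open_borel|exact: cu|exact: ltW|exact: u0|].
  move=> x /= fx; rewrite /u /slice le_min lexx andbT le_max; apply/orP; left.
  by rewrite -natr1 mulrDl mul1r in fx; lra.
(* Each slice is compared with its predecessor; the zeroth one, which has none, contributes at most
   [h], below [e]. *)
rewrite [in leLHS]fE (state_bigsum _ sL)// big_ord_recl addrC; apply: lerD.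
  apply: (@le_trans _ _ (\sum_(i < N) integral_state mu (u i))).
    by apply: ler_sum => i _; apply: le_trans (Lu _) (uI i).
  rewrite -(state_bigsum _ smu)//; apply: state_le => //; first exact: cts_sum.
  by move=> x; rewrite [in leRHS]fE big_ord_recr/= lerDl.
apply: le_trans (Lu 0%N) _; apply: le_trans (ltW hN).
by rewrite ler_piMr ?(ltW h0)//; exact: content_le1.
Qed.

(** The inequality applied to [g] and to [1 - g] gives equality for values in [0, 1]; an affine
    change of scale reaches every continuous function. *)
Lemma riesz_integral (L : (X -> R) -> R) (sL : state L) f : continuous f ->
  integral_state (riesz_measure nX cX sL) f = L f.
Proof.
move=> cf; set mu := riesz_measure _ _ _.
have smu := integral_state_state cX mu.
have le01 g : continuous g -> (forall x, 0 <= g x <= 1) -> integral_state mu g = L g.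
  move=> cg g01; apply/eqP; rewrite eq_le (riesz_le sL)// andbT.
  have : L (fun x => 1 - g x) <= integral_state mu (fun x => 1 - g x).
    apply: (riesz_le sL); first by apply: ctsB => //; exact: ctsC.
    by move=> x; have /andP[? ?] := g01 x; apply/andP; split; lra.
  rewrite (stateB sL)//; last exact: ctsC.
  rewrite (stateB smu)//; last exact: ctsC.
  by rewrite (state_cst sL) (state_cst smu); lra.
have [B B0 fB] := cts_bounded cX cf.
have cg : continuous (fun x => (2 * B)^-1 * (f x + B)).
  by apply: ctsZ; apply: ctsD => //; exact: ctsC.
rewrite (_ : f = fun x => (2 * B) * ((2 * B)^-1 * (f x + B)) - B); last first.
  by apply/funext => x; rewrite mulVKf ?addrK// mulf_neq0// gt_eqF.
rewrite (stateB sL); [|exact: ctsZ|exact: ctsC].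
rewrite (stateB smu); [|exact: ctsZ|exact: ctsC].
rewrite (stateZ sL)// (stateZ smu)// (state_cst sL) (state_cst smu) le01// => x.
have := fB x; rewrite ler_norml => /andP[h1 h2].
have B2 : 0 < 2 * B by rewrite mulr_gt0.
by rewrite mulr_ge0 ?invr_ge0 ?(ltW B2)//= ?ler_pdivrMl//; lra.
Qed.

Hypothesis openF : forall U : set X, open U -> exists2 K : nat -> set X,
  (forall n, closed (K n)) & \bigcup_n K n = U.

(** [U] is an increasing union of closed sets; a Urysohn function between one of these and [U]
    bounds its [mu] measure by [nu U], through the common integral. *)
Lemma measure_le_open mu nu (U : set X) : open U ->
  (forall f, continuous f -> integral_state mu f = integral_state nu f) ->
  (mu (U : set (borel_type X)) <= nu (U : set (borel_type X)))%E.
Proof.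
move=> oU E; have [K cK KU] := openF oU.
have mK n : measurable (K n : set (borel_type X)).
  by rewrite -[K n]setCK; apply: measurableC; apply: open_borel; exact: closed_openC.
pose F n : set (borel_type X) := \bigcup_(i < n) K i.
have cF n : closed (F n : set X).
  by rewrite /F bigcup_mkord; apply: closed_bigsetU => i _.
have mF n : measurable (F n) by apply: bigcup_measurable => i _; exact: mK.
have FU : \bigcup_n F n = U.
  rewrite -KU; apply/seteqP; split => [x [n _ [i /= _ Kx]]|x [i _ Kx]]; first by exists i.
  by exists i.+1 => //; exists i => /=.
have ndF : {homo F : n m / (n <= m)%N >-> (n <= m)%O}.
  move=> n m nm; apply/subsetPset => x [i /= ni Kx]; exists i => //=.
  exact: leq_trans nm.
have mUF : measurable (\bigcup_n F n) by exact: bigcupT_measurable.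
have := nondecreasing_cvg_mu (mu := mu) mF mUF ndF; rewrite FU => h.
apply: (@closed_cvg _ _ \oo _ (mu \o F) [set t | (t <= nu U)%E] _ _ _ h).
  exact: closed_ereal_ge_ereal.
apply: nearW => n /=.
have FnU : F n `<=` U by rewrite -FU => x Fx; exists n.
have [g [cg g01 g1 g0]] := urysohn_bump (R := R) nX (cF n) oU FnU.
have g_ge0 x : 0 <= g x by have /andP[] := g01 x.
have := @cts_markov mu g (F n) 1 (mF n) cg ler01 g_ge0.
rewrite mul1e => /(_ _)/le_trans; apply; first by move=> x Fx; rewrite g1.
rewrite E// -(integral_stateE cX)//.
have mU : measurable (U : set (borel_type X)) by exact: open_borel.
have <- : (\int[nu]_x (\1_(U : set (borel_type X)) x)%:E)%E = nu U.
  by rewrite integral_indic// setIT.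
apply: ge0_le_integral => //.
- by move=> x _; rewrite lee_fin.
- by apply/measurable_EFinP; exact: cts_measurable.
- by apply/measurable_EFinP; exact: measurable_indic.
- move=> x _; rewrite lee_fin indicE; case: (boolP (x \in _)) => xU /=.
    by have /andP[] := g01 x.
  by rewrite g0// => Ux; move/negP: xU; apply; exact: mem_set.
Qed.

Lemma measure_eq_integral mu nu :
  (forall f, continuous f -> integral_state mu f = integral_state nu f) ->
  forall A : set (borel_type X), measurable A -> mu A = nu A.
Proof.
move=> E A mA.
apply: (@measure_unique _ R (borel_type X) (@open X) (fun=> setT)) => //.
- by move=> U V; exact: openI.
- by move=> _; exact: openT.
- by apply/seteqP; split => // x _; exists 0%N.
- move=> U oU; apply/eqP; rewrite eq_le; apply/andP; split; apply: measure_le_open => //.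
  by move=> f cf; rewrite E.
- by move=> k; exact: le_lt_trans (probability_le1 mu measurableT) (ltry 1).
Qed.

End RieszRepresentation.

(** * The theorem for measures *)

Section CompactMetric.
Context {R : realType} {X : pseudoPMetricType R}.
Hypothesis hX : hausdorff_space X.
Hypothesis cX : compact [set: X].

Lemma countable_basis : exists E : nat -> set X, (forall n, open (E n)) /\
  forall x V, nbhs x V -> exists n, E n x /\ E n `<=` V.
Proof.
have [B cB [oB hB]] := compact_second_countable cX.
have /countable_injP[c inj_c] := cB.
exists (fun n => xget set0 [set U | B U /\ c U = n]); split=> [n|x V Vx].
  by case: xgetP => [U _ [BU _]|_]; [exact: oB|exact: open0].
have [U [BU Ux] UV] := hB x V Vx.
exists (c U); case: xgetP => [W _ [BW cW]|/(_ U)[]//].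
by rewrite (inj_c W U) ?inE.
Qed.

Lemma dense_sequence : exists D : nat -> X,
  forall V, open V -> V !=set0 -> exists i, V (D i).
Proof.
have [E [oE hE]] := countable_basis.
exists (fun n => xget point (E n)) => V oV [x Vx].
have [n [Enx EV]] := hE x V (open_nbhs_nbhs (conj oV Vx)).
by exists n; apply: EV; case: xgetP => [y _|/(_ x)].
Qed.

(** One Urysohn function for each pair of basic open sets. A pair that is not separated still gives
    a continuous function, and around each [x] some pair is separated by a half-radius ball. *)
Lemma separating_family : exists f : nat -> X -> R, (forall l, continuous (f l)) /\
  forall x V, nbhs x V -> exists2 l, f l x = 0 & forall y, f l y < 1 -> V y.
Proof.
have [E [oE hE]] := countable_basis.
exists (fun l => if unpickle l is Some (n, m) then Urysohn (R := R) (E n) (~` E m) else fun=> 0).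
split=> [l|x V Vx].
  case: (unpickle l) => [[n m]|]; [exact: Urysohn_continuous|exact: ctsC].
have [m [Emx EmV]] := hE x V Vx.
have [e /= e0 xe] : nbhs_ball x (E m) by rewrite nbhs_ballE; exact: open_nbhs_nbhs.
have e2 : 0 < e / 2 by rewrite divr_gt0.
have [n [Enx Ene]] := hE x (ball x (e / 2)) (nbhsx_ballx _ _ e2).
have sep : uniform_separator (E n) (~` E m).
  apply: uniform_separatorW; exists [set p | ball p.1 (e / 2) p.2].
    exact: entourage_ball (PosNum e2).
  apply/seteqP; split => // -[a b] [[/= Ea nEb] ab]; apply: nEb; apply: xe.
  by rewrite /= [e]splitr; apply: ball_triangle ab; exact: Ene.
exists (pickle (n, m)); rewrite pickleK.
  by apply: (Urysohn_sub0 sep); exists x.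
move=> y; rewrite ltNge => /negP hy; apply: EmV; apply: contrapT => nEy; apply: hy.
by rewrite (_ : Urysohn _ _ y = 1)//; apply: (Urysohn_sub1 sep); exists y.
Qed.

Lemma open_Fsigma (U : set X) : open U -> exists2 K : nat -> set X,
  (forall n, closed (K n)) & \bigcup_n K n = U.
Proof.
move=> oU; have [f [cf hf]] := separating_family.
exists (fun l => if pselect (forall y, f l y < 1 -> U y) then [set y | f l y <= 2^-1] else set0).
  move=> l; case: pselect => h; last exact: closed0.
  by apply: (@closed_comp _ _ (f l) [set t | t <= 2^-1]); [move=> y _; exact: cf|exact: closed_le].
apply/seteqP; split=> [x [l _]|x Ux].
  case: pselect => // h /= fx; apply: h; apply: le_lt_trans fx _.
  by rewrite invf_lt1// ltr1n.
have [l fx h] := hf x U (open_nbhs_nbhs (conj oU Ux)).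
by exists l => //; case: pselect => //= _; rewrite fx invr_ge0.
Qed.

Let nX : normal_space X := compact_normal hX cX.

Lemma MX_eq_integral (mu nu : MX X) :
  (forall f : X -> R, continuous f -> integral_state mu f = integral_state nu f) ->
  meas_eq mu nu.
Proof. by move=> E A mA; apply: (measure_eq_integral nX cX open_Fsigma). Qed.

Lemma meas_eq_integral (mu nu : MX X) : meas_eq mu nu ->
  forall f, integral_state mu f = integral_state nu f.
Proof.
move=> E f; rewrite /integral_state; congr fine.
by apply: eq_measure_integral => A mA _; exact: E.
Qed.

(** * Passage between measures and functionals, and the two implications *)

Section Action.
Context {G : topologicalType} (mul : G -> G -> G) (one : G) (inv : G -> G)
  (act : G -> X -> X).
Hypothesis act1 : forall x, act one x = x.
Hypothesis actM : forall g h x, act (mul g h) x = act g (act h x).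
Hypothesis actV : forall g x, act (inv g) (act g x) = x.
Hypothesis actC : forall g, continuous (act g).

(** If [phi x = phi y], translations close to [phi] at both points bring [x] and [y] arbitrarily
    near each other. *)
Lemma distal_env_inj : distal_action act -> forall phi, env_elt act phi -> injective phi.
Proof.
move=> dis phi [F PF hF] x y xy; apply: contrapT => /dis[e [e0 he]].
have e2 : 0 < e / 2 by rewrite divr_gt0.
have hx : F [set g | ball (phi x) (e / 2) (act g x)] := hF x _ (nbhsx_ballx (phi x) _ e2).
have hy : F [set g | ball (phi y) (e / 2) (act g y)] := hF y _ (nbhsx_ballx (phi y) _ e2).
have [g [gx gy]] := filter_ex (filterI hx hy).
apply: (he g); rewrite [e]splitr; apply: (ball_triangle (y := phi x)).
  exact: ball_sym.
by rewrite xy.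
Qed.

Lemma env_elt_in_enveloping phi : env_elt act phi -> in_enveloping act phi.
Proof.
move=> [F PF hF] n xs U hU.
have h : F [set g | forall i, i \in enum 'I_n -> U i (act g (xs i))].
  apply: filter_mem => i _; have [oU Ui] := hU i.
  exact: (hF (xs i) _ (open_nbhs_nbhs (conj oU Ui))).
by have [g hg] := filter_ex h; exists g => i; apply: hg; rewrite mem_enum.
Qed.

Definition measure_of (L : (X -> R) -> R) : MX X :=
  if pselect (state L) is left sL then riesz_measure nX cX sL else diracM point.

Lemma measure_ofE L f : state L -> continuous f -> integral_state (measure_of L) f = L f.
Proof.
move=> sL cf; rewrite /measure_of; case: pselect => // s; exact: riesz_integral.
Qed.

(** An operator on states becomes a map [p] on measures by integrating, applying the operator and
    taking the Riesz measure of the result. *)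
Lemma injective_system_env : injective_system act -> injective_env (R := R) act.
Proof.
move=> inj T T' phi ET ET' Ephi Tphi T'phi L f sL cf.
pose p (T : ((X -> R) -> R) -> (X -> R) -> R) (nu : MX X) : MX X :=
  measure_of (T (integral_state nu)).
have sI (nu : MX X) : state (integral_state nu) by exact: integral_state_state.
have pE S (nu : MX X) g : env_op act S -> continuous g ->
    integral_state (p S nu) g = S (integral_state nu) g.
  by move=> ES cg; rewrite /p measure_ofE//; exact: env_op_state.
have envp S : env_op act S -> in_enveloping_M act (p S).
  move=> ES n m nus fs cfs e e0; have [F PF hF] := ES.
  have h : F [set g | forall i, i \in enum 'I_n -> forall j, j \in enum 'I_m ->
      `|S (integral_state (nus i)) (fs j) - integral_state (nus i) (fun x => fs j (act g x))| < e].
    apply: filter_mem => i _; apply: filter_mem => j _.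
    by have /cvgrPdist_lt/(_ _ e0) := hF _ _ (sI (nus i)) (cfs j).
  have [g hg] := filter_ex h; exists g => i j.
  have cg : continuous (fun x => fs j (act g x)) by exact: cts_comp.
  rewrite (integral_stateE cX _ (cfs j)) (integral_stateE cX _ cg).
  by rewrite -EFinB /= lte_fin pE//; apply: hg; rewrite mem_enum.
have resp S : env_op act S ->
    (forall x f, continuous f -> S (evaluation x) f = f (phi x)) -> restricts_to (p S) phi.
  move=> ES Sphi x; apply: MX_eq_integral => g cg.
  rewrite pE// (integral_state_dirac cX)// -Sphi//.
  have [F PF hF] := ES.
  apply: (lim_eq (hF _ _ (sI _) cg) (hF _ _ (state_evaluation x) cg)).
  apply: filterE => h /=; rewrite (integral_state_dirac cX)//; exact: cts_comp.
have TE := inj _ _ _ (envp _ ET) (envp _ ET') (env_elt_in_enveloping Ephi)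
  (resp _ ET Tphi) (resp _ ET' T'phi) (measure_of L).
have := meas_eq_integral TE f; rewrite !pE//.
(* Integration against [measure_of L] and [L] itself agree on continuous functions only; a limit
   transfers this to [S]. *)
have red S : env_op act S -> S (integral_state (measure_of L)) f = S L f.
  move=> [F PF hF]; apply: (lim_eq (hF _ _ (sI _) cf) (hF _ _ sL cf)).
  by apply: filterE => g /=; rewrite measure_ofE//; exact: cts_comp.
by rewrite !red.
Qed.

Lemma injective_equicontinuous : distal_action act -> minimal_action act ->
  injective_system act -> equicontinuous [set: G] act.
Proof.
move=> dis minA inj x E entE.
have [f [cf hf]] := separating_family.
have [D hD] := dense_sequence.
have sep y V : nbhs y V -> exists l, exists2 d : R, 0 < d &
    forall z, `|f l z - f l y| < d -> V z.
  move=> /hf[l fy h]; exists l, 1 => // z; rewrite fy subr0 => hz; apply: h.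
  exact: le_lt_trans (ler_norm _) hz.
have eqf l e := equicontinuous_fsep hX cX act1 actM actV actC (distal_env_inj dis)
  (injective_system_env inj) cf sep hD minA l (e := e) x.
apply: near_forall_ultra => W UW Wx Wbad.
have PW : ProperFilter W by exact: ultra_proper.
have [a _ ha] := @ultra_compact_cvg _ X W (fun p => act p.1 x) setT UW cX filterT.
have [b _ hb] := @ultra_compact_cvg _ X W (fun p => act p.1 p.2) setT UW cX filterT.
(* Along [W] the bounds on every [f l] become equalities, and the [f l] separate points. *)
have ab : a = b.
  apply: (fsep_inj hX sep) => l; apply/eqP; rewrite eq_sym -subr_eq0 -normr_le0.
  apply/ler_addgt0Pr => e e0; rewrite add0r.
  have h1 : (fun p : G * X => `|f l (act p.1 p.2) - f l (act p.1 x)|) @ W --> `|f l b - f l a|.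
    by apply: cvg_norm; apply: cvgB; apply: continuous_cvg => //; exact: cf.
  have h2 : (fun _ : G * X => e) @ W --> e by exact: cvg_cst.
  apply: (lim_le h1 h2); apply: filterS (Wx _ (eqf l e e0)) => p /=; exact.
have entS := entourage_split_ent entE.
have na : nbhs a (xsection (split_ent E) a) by exact: nbhs_entourage.
have nb : nbhs a [set z | split_ent E (z, a)].
  by have := nbhs_entourage a (entourage_inv entS); apply: filterS => z /xsectionP.
have Wa : W [set p | split_ent E (act p.1 x, a)] := ha _ nb.
rewrite -ab in hb; have Wb : W [set p | xsection (split_ent E) a (act p.1 p.2)] := hb _ na.
have [p [[/= pa /xsectionP pb] bp]] := filter_ex (filterI (filterI Wa Wb) Wbad).
by apply: bp => _; exact: entourage_split pa pb.
Qed.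

(** Translations [g] and [h] approximate [p] and [q] within [d] at [nu], and [phi] on a finite net;
    then [f] after [g] and [f] after [h] differ by at most [4 * d] everywhere. The total [6 * d] is
    below [e = 8 * d]. *)
Lemma equicontinuous_injective : equicontinuous [set: G] act -> injective_system act.
Proof.
move=> eqc p q phi Ep Eq _ rp rq nu; apply: MX_eq_integral => f cf.
have sI (mu : MX X) : state (integral_state mu) by exact: integral_state_state.
apply/eqP; rewrite -subr_eq0 -normr_le0; apply/ler_addgt0Pr => e e0; rewrite add0r.
pose d := e / 8; have d0 : 0 < d by rewrite divr_gt0.
(* Along [W] the images of [x] and of the nearby points have the same limit [a] by equicontinuity;
   continuity of [f] at [a] does the rest. *)
have osc x : nbhs x [set y | forall g, `|f (act g x) - f (act g y)| < d].
  apply: near_forall_ultra => W UW Wx Wbad.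
  have PW : ProperFilter W by exact: ultra_proper.
  have [a _ ha] := @ultra_compact_cvg _ X W (fun p => act p.1 x) setT UW cX filterT.
  have hb : (fun p : G * X => act p.1 p.2) @ W --> a.
    apply/cvg_entourageP => E entE; have entS := entourage_split_ent entE.
    have Wa : W [set p | xsection (split_ent E) a (act p.1 x)] := ha _ (nbhs_entourage a entS).
    have Wb := Wx _ (eqc x _ entS).
    change (W [set z | E (a, act z.1 z.2)]); apply: filterS2 Wa Wb => z /= /xsectionP pa pb.
    exact: entourage_split pa (pb z.1 I).
  have h0 : (fun p : G * X => f (act p.1 x) - f (act p.1 p.2)) @ W --> (0 : R).
    by rewrite -(subrr (f a)); apply: cvgB; apply: continuous_cvg => //; exact: cf.
  have /cvgrPdist_lt/(_ _ d0) W0 := h0.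
  have [z [/= zd zbad]] := filter_ex (filterI W0 Wbad).
  by apply: zbad; move: zd; rewrite sub0r normrN.
pose O x := [set y | forall g, `|f (act g x) - f (act g y)| < d]^°.
have [xs _ cov] : finite_subset_cover [set: X] O [set: X].
  have : cover_compact [set: X] by rewrite -compact_cover.
  apply=> [x _|x _]; first exact: open_interior.
  by exists x => //; exact: osc.
pose r := finmap.enum_fset xs.
have covr y : exists2 x, x \in r & forall g, `|f (act g x) - f (act g y)| < d.
  have [x /= xr /interior_subset h] := cov y I.
  by exists x.
(* [nu] and the Dirac masses of the net form one list, so that a single translation approximates at
   all of them. *)
pose nus (i : 'I_(size r).+1) : MX X := if unlift ord0 i is Some j then diracM (nth point r j) else nu.
have approx P : in_enveloping_M act P -> restricts_to P phi ->
    exists g, `|integral_state (P nu) f - integral_state nu (fun x => f (act g x))| < d /\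
      forall x, x \in r -> `|f (phi x) - f (act g x)| < d.
  move=> EP rP; have [g hg] := EP _ 1%N nus (fun=> f) (fun=> cf) d d0.
  have cg : continuous (fun x => f (act g x)) by exact: cts_comp.
  have {}hg i : `|integral_state (P (nus i)) f - integral_state (nus i) (fun x => f (act g x))| < d.
    have := hg i ord0.
    by rewrite (integral_stateE cX _ cf) (integral_stateE cX _ cg) -EFinB /= lte_fin.
  exists g; split; first by have := hg ord0; rewrite /nus unlift_none.
  move=> x xr; have xi : (index x r < size r)%N by rewrite index_mem.
  have := hg (lift ord0 (Ordinal xi)); rewrite /nus liftK/= nth_index//.
  rewrite (meas_eq_integral (rP x)) !(integral_state_dirac cX)//.
have [g [g1 g2]] := approx p Ep rp; have [h [h1 h2]] := approx q Eq rq.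
have cg : continuous (fun x => f (act g x)) by exact: cts_comp.
have ch : continuous (fun x => f (act h x)) by exact: cts_comp.
have gh y : `|f (act g y) - f (act h y)| <= 4 * d.
  have [x xr hx] := covr y; have := g2 x xr; have := h2 x xr; have := hx g; have := hx h.
  rewrite !ltr_norml ler_norml.
  move=> /andP[? ?] /andP[? ?] /andP[? ?] /andP[? ?]; apply/andP; split; lra.
have : `|integral_state nu (fun x => f (act g x)) - integral_state nu (fun x => f (act h x))| <= 4 * d.
  by rewrite -(stateB (sI nu))//; apply: (state_bound (sI nu)) => //; exact: ctsB.
move: g1 h1; rewrite !ltr_norml !ler_norml.
move=> /andP[? ?] /andP[? ?] /andP[? ?].
have : e = 8 * d by rewrite /d; field.
by move=> ->; apply/andP; split; lra.
Qed.
End Action.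
End CompactMetric.

Theorem mainTheorem3 (R : realType) (X : pseudoPMetricType R)
    (G : topologicalType) (mul : G -> G -> G) (one : G) (inv : G -> G)
    (act : G -> X -> X) :
  hausdorff_space X ->
  compact [set: X] ->
  topological_group mul one inv ->
  continuous_action mul one act ->
  minimal_action act ->
  distal_action act ->
  (injective_system act <-> equicontinuous [set: G] act).
Proof.
move=> hX cX [_ _ mulV _ _] [act1 actM actC] minA dis.
have actCg g : continuous (act g).
  move=> x; apply: (@continuous_comp _ _ _ (fun y => (g, y)) (fun p => act p.1 p.2)).
    by apply: cvg_pair; [exact: cvg_cst|exact: cvg_id].
  exact: actC.
have actV g x : act (inv g) (act g x) = x by rewrite -actM (mulV g).1 act1.
split.
- exact: (injective_equicontinuous hX cX act1 actM actV actCg dis minA).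
- exact: (equicontinuous_injective hX cX actCg).
Qed.
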